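(* Let $X_1,\dots,X_n$ be i.i.d. from $P$ on $[0,1]^r$ with cdf $F$ and bounded density $p$, and let $B:=\log\sup_x p(x)>0$. Let $\rho$ be the Kolmogorov–Smirnov distance $\rho(F,G)=\sup_{t\in[0,1]^r}|F(t)-G(t)|$ and let $Z=(Z_1,\dots,Z_k)$ be drawn from the exponential mechanism based on $\rho$, with $k=k_n\asymp(3\alpha/B)^{2/3}n^{2/3}$. Then, with $\epsilon_n=2(B/(3\alpha))^{1/3}n^{-1/3}$, $$\rho(F,\hat F_Z)=O_P(\epsilon_n).$$
   Context: $\delta(x,y)=\#\{i:x_i\ne y_i\}$ is the Hamming distance between databases. For $u\in([0,1]^r)^\ell$, $\hat F_u$ denotes the empirical cdf of $u_1,\dots,u_\ell$ (componentwise order). Exponential mechanism based on $\rho$: with $\alpha>0$ and $\Delta_{n,k}=\sup_{x,y\in\mathcal X^n,\delta(x,y)=1}\sup_{z\in\mathcal X^k}|\rho(\hat F_x,\hat F_z)-\rho(\hat F_y,\hat F_z)|$, the output $Z\in\mathcal X^k$ has density (w.r.t. Lebesgue measure on $\mathcal X^k$) $h(z\mid x)=g_x(z)/\int_{\mathcal X^k}g_x(s)\,ds$ where $g_x(z)=\exp\big(-\alpha\rho(\hat F_x,\hat F_z)/(2\Delta_{n,k})\big)$. $O_P$ refers to the joint law of $X\sim P^n$ and $Z$; $a_n\asymp b_n$ means $a_n/b_n$ and $b_n/a_n$ are bounded for large $n$. *)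

(* Defs.v *)
From HB Require Import structures.
From mathcomp Require Import all_boot all_order all_algebra.
From mathcomp Require Import all_classical all_reals all_analysis.
Unset Printing Implicit Defensive.
Import Order.TTheory GRing.Theory Num.Theory.
Local Open Scope classical_set_scope.
Local Open Scope ring_scope.

Section defs.
Context {R : realType}.

Definition unit_cube (r : nat) : set (r.-tuple R) :=
  [set t | forall j : 'I_r, 0 <= tnth t j <= 1].

Definition db_space (r l : nat) : set (l.-tuple (r.-tuple R)) :=
  [set u | forall i : 'I_l, unit_cube r (tnth u i)].

(* iterated integral over T^m built from an integral I over T *)
Fixpoint tint (T : Type) (I : (T -> \bar R) -> \bar R) (m : nat) :
  (m.-tuple T -> \bar R) -> \bar R :=
  match m return (m.-tuple T -> \bar R) -> \bar R with
  | 0 => fun f => f [tuple]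
  | m'.+1 => fun f => tint T I m' (fun v => I (fun t => f (cons_tuple t v)))
  end.

Definition int01 (g : R -> \bar R) : \bar R :=
  (\int[@lebesgue_measure R]_(t in `[0%R, 1%R]) g t)%E.

Definition cube_int (r : nat) : (r.-tuple R -> \bar R) -> \bar R :=
  tint _ int01 r.

Definition db_int (r l : nat) : (l.-tuple (r.-tuple R) -> \bar R) -> \bar R :=
  tint _ (cube_int r) l.

Definition tle (r : nat) (y t : r.-tuple R) : bool :=
  [forall j : 'I_r, tnth y j <= tnth t j].

Definition cdf_of_density (r : nat) (p : r.-tuple R -> R) (t : r.-tuple R) : R :=
  fine (cube_int r (fun y => (p y * (tle r y t)%:R)%:E)).

Definition ecdf (r l : nat) (u : l.-tuple (r.-tuple R)) (t : r.-tuple R) : R :=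
  (#|[set i : 'I_l | tle r (tnth u i) t]|)%:R / l%:R.

Definition KS (r : nat) (F G : r.-tuple R -> R) : R :=
  sup [set `|F t - G t| | t in unit_cube r].

Definition hamming (r n : nat) (x y : n.-tuple (r.-tuple R)) : nat :=
  #|[set i : 'I_n | tnth x i != tnth y i]|.

Definition sensitivity (r n k : nat)
    (rho : (r.-tuple R -> R) -> (r.-tuple R -> R) -> R) : R :=
  sup [set d : R | exists (x y : n.-tuple (r.-tuple R)) (z : k.-tuple (r.-tuple R)),
        [/\ db_space r n x, db_space r n y, hamming r n x y = 1%N, db_space r k z &
            d = `|rho (ecdf r n x) (ecdf r k z) - rho (ecdf r n y) (ecdf r k z)|] ].

Definition expmech_g (r n k : nat) (rho : (r.-tuple R -> R) -> (r.-tuple R -> R) -> R)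
    (alpha : R) (x : n.-tuple (r.-tuple R)) (z : k.-tuple (r.-tuple R)) : R :=
  expR (- (alpha * rho (ecdf r n x) (ecdf r k z)) / (2 * sensitivity r n k rho)).

Definition expmech_h (r n k : nat) (rho : (r.-tuple R -> R) -> (r.-tuple R -> R) -> R)
    (alpha : R) (x : n.-tuple (r.-tuple R)) (z : k.-tuple (r.-tuple R)) : R :=
  expmech_g r n k rho alpha x z / fine (db_int r k (fun s => (expmech_g r n k rho alpha x s)%:E)).

(* joint probability of the event E(X, Z), X ~ P^n with P of density p on
   [0,1]^r, and Z | X = x ~ h(. | x) *)
Definition joint_prob (r n k : nat) (p : r.-tuple R -> R)
    (rho : (r.-tuple R -> R) -> (r.-tuple R -> R) -> R) (alpha : R)
    (E : n.-tuple (r.-tuple R) -> k.-tuple (r.-tuple R) -> bool) : \bar R :=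
  db_int r n (fun x =>
    ((\prod_(i < n) p (tnth x i))%:E *
     db_int r k (fun z => (expmech_h r n k rho alpha x z * (E x z)%:R)%:E))%E).

End defs.

(* Main.v *)
(** Proof idea. A sample of size n from a bounded density satisfies
    KS(F, F_X) = O(n^(-1/2)) with high probability: a lower orthant is split, by
    rounding its corner down to dyadic grids of mesh 2^-j, into layers of
    probability O(2^-j). There are O(2^(j r)) layers of level j, and an exponential
    moment bound controls their frequencies up to (3/4)^j n^(-1/2) simultaneously,
    for all j with 4^j <= n; the deviations form a convergent geometric series.

    The sensitivity lies in ]0, 1/n], so that
    g_x(z) = exp(- A KS(F_x, F_z)) with A >= alpha n / 2. Since p <= e^B, the Lebesgue
    measure of {z : KS(F, F_z) <= d} is at least e^(- B k) times its P^k-probability,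
    and the latter is at least 1/2 when d is of order k^(-1/2). This bounds
    the normalizing constant from below, and if tau exceeds the sampling errors
    P(KS(F, F_Z) > tau) is at most a multiple of exp(B k - A tau'), where tau' is
    tau minus these errors. With k of order n^(2/3), the terms B k and A eps_n are
    both of order n^(2/3), and a large multiple of eps_n makes the bound vanish. *)

Require Import Defs.
From HB Require Import structures.
From mathcomp Require Import all_boot all_order all_algebra.
From mathcomp Require Import all_classical all_reals all_analysis.
From mathcomp Require Import measurable_realfun ring lra zify.
Import Order.TTheory GRing.Theory Num.Theory.
Local Open Scope classical_set_scope.
Local Open Scope ring_scope.
Set Implicit Arguments.
Unset Strict Implicit.

(** * Iterated integrals *)

Section monotone_integral.
Import HBNNSimple.
Local Open Scope ereal_scope.
Context d (T : measurableType d) (R : realType) (mu : {measure set T -> \bar R}).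
Implicit Types (D : set T) (f g : T -> \bar R).

(* The integral of a nonnegative function is a supremum over the simple
   functions below it, so that no measurability is needed here. *)
Lemma ge0_le_integral_nonmeas D f g : (forall t, D t -> 0 <= f t) ->
  (forall t, D t -> f t <= g t) ->
  \int[mu]_(t in D) f t <= \int[mu]_(t in D) g t.
Proof.
move=> f0 fg.
have g0 t : D t -> 0 <= g t by move=> Dt; exact: le_trans (f0 _ Dt) (fg _ Dt).
rewrite !ge0_integralE//; apply: ge_ereal_sup => _ [h /= hf <-].
apply: ereal_sup_ubound; exists h => //= x; apply: le_trans (hf x) _.
by rewrite !patchE; case: ifPn => // /[!inE] /fg.
Qed.

(** Scaling the simple functions below the integrand gives one inequality for every positive factor;
    applying it to [c^-1] and [c * f] gives the converse. *)
Lemma ge0_integralZl_nonmeas D (c : R) f : (0 <= c)%R ->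
  (forall t, D t -> 0 <= f t) ->
  \int[mu]_(t in D) (c%:E * f t) = c%:E * \int[mu]_(t in D) f t.
Proof.
rewrite le_eqVlt => /predU1P[<- f0|c0 f0].
  by rewrite mul0e; apply: integral0_eq => t Dt; rewrite mul0e.
have le_scale (a : R) g : (0 < a)%R -> (forall t, D t -> 0 <= g t) ->
    a%:E * \int[mu]_(t in D) g t <= \int[mu]_(t in D) (a%:E * g t).
  move=> a0 g0; rewrite -lee_pdivlMl// !ge0_integralE//; last first.
    by move=> t Dt; rewrite mule_ge0 ?g0// lee_fin ltW.
  apply: ge_ereal_sup => _ [h /= hg <-].
  rewrite lee_pdivlMl// -sintegralrM; apply: ereal_sup_ubound.
  exists (scale_nnsfun h (ltW a0)) => //= x.
  rewrite EFinM patchE; move: (hg x); rewrite patchE; case: ifPn => _ hx.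
    by rewrite lee_pmul2l.
  by apply: (@le_trans _ _ (a%:E * 0)); [rewrite lee_pmul2l|rewrite mule0].
apply/eqP; rewrite eq_le; apply/andP; split; last exact: le_scale.
have cf0 t : D t -> 0 <= c%:E * f t.
  by move=> Dt; rewrite mule_ge0 ?f0// lee_fin ltW.
have := @le_scale c^-1%R (fun t => c%:E * f t).
rewrite invr_gt0 => /(_ c0 cf0); rewrite lee_pdivrMl//.
congr (_ <= _ * _); apply: eq_integral => t _.
by rewrite muleA -EFinM mulVf ?gt_eqF// mul1e.
Qed.

End monotone_integral.

Section integral_like.
Local Open Scope ereal_scope.
Context {R : realType}.

(** The rules shared by the integral over [[0, 1]] and its iterates, which are handled as
    functionals and not as integrals against a product measure. Comparison and scaling look only at
    [D] and ask for no measurability; [il_meas], measurability in a parameter, lets additivity pass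
    through iteration. *)
Record integral_like d (T : measurableType d) (D : set T)
    (I : (T -> \bar R) -> \bar R) : Prop := IntegralLike {
  il_le : forall f g, (forall t, D t -> 0 <= f t) ->
    (forall t, D t -> f t <= g t) -> I f <= I g ;
  il_Z : forall (c : R) f, (0 <= c)%R -> (forall t, D t -> 0 <= f t) ->
    I (fun t => c%:E * f t) = c%:E * I f ;
  il_1 : I (cst 1) = 1 ;
  il_D : forall f g : T -> \bar R, measurable_fun setT f -> measurable_fun setT g ->
    (forall t, 0 <= f t) -> (forall t, 0 <= g t) ->
    I (fun t => f t + g t) = I f + I g ;
  il_meas : forall d' (U : measurableType d') (f : T * U -> \bar R),
    measurable_fun setT f -> (forall x, 0 <= f x) ->
    measurable_fun setT (fun u => I (fun t => f (t, u))) }.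

Definition tuples_in (T : Type) (D : set T) m : set (m.-tuple T) :=
  [set v | forall i, D (tnth v i)].
Arguments tuples_in {T} D m _ /.

Lemma tnth_cons_tuple0 (T : Type) m (t : T) (v : m.-tuple T) :
  tnth (cons_tuple t v) ord0 = t.
Proof. by rewrite (tnth_nth t). Qed.

Lemma tnth_cons_tupleS (T : Type) m (t : T) (v : m.-tuple T) (i : 'I_m) :
  tnth (cons_tuple t v) (lift ord0 i) = tnth v i.
Proof. by rewrite !(tnth_nth t). Qed.

Lemma tuples_in_cons (T : Type) (D : set T) m (t : T) (v : m.-tuple T) :
  D t -> tuples_in D m v -> tuples_in D m.+1 (cons_tuple t v).
Proof.
move=> Dt Dv i; have [<-|/unlift_some[j -> _]] := eqVneq ord0 i.
  by rewrite tnth_cons_tuple0.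
by rewrite tnth_cons_tupleS.
Qed.

Lemma integral_like_int01 :
  integral_like (T := R) [set t : R | (0 <= t <= 1)%R] (@int01 R).
Proof.
split.
- move=> f g f0 fg; apply: ge0_le_integral_nonmeas => t /=.
    by rewrite in_itv/= => /f0.
  by rewrite in_itv/= => /fg.
- by move=> c f c0 f0; apply: ge0_integralZl_nonmeas.
- transitivity (1 * @lebesgue_measure R `[0%R, 1%R]).
    by rewrite /int01 -integral_cst.
  by rewrite mul1e lebesgue_measure_itv/= lte_fin ltr01 sube0.
- move=> f g mf mg f0 g0; apply: ge0_integralD => //.
    exact: measurable_funTS.
  exact: measurable_funTS.
- move=> d' U f mf f0.
  (* Extension by 0 outside [[0, 1]] gives an integral over the whole line, whose measurability in
     the parameter is part of Tonelli's theorem. *)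
  pose h (x : R * U) := (f \_ (`[0%R, 1%R] `*` setT)) x.
  have mh : measurable_fun [set: R * U] h.
    have mD : measurable (`[0%R, 1%R]%classic `*` [set: U] : set (R * U)).
      by apply: measurableX => //; exact: measurable_itv.
    apply: (proj1 (measurable_restrictT f mD)).
    exact: measurable_funTS.
  rewrite (_ : (fun u => _) = fubini_G (@lebesgue_measure R) h).
    by apply: measurable_fun_fubini_tonelli_G => // x; exact: erestrict_ge0.
  apply/funext => u; rewrite /int01 [LHS]integral_mkcond.
  apply: eq_integral => t _; rewrite /h !patchE in_setX in_setT andbT.
  by case: ifPn.
Qed.

Section integral_like_theory.
Context d (T : measurableType d) (D : set T) (I : (T -> \bar R) -> \bar R).
Hypothesis IL : integral_like D I.

Lemma il_eq f g : (forall t, D t -> 0 <= f t) -> (forall t, D t -> f t = g t) ->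
  I f = I g.
Proof.
move=> f0 fg; apply/eqP; rewrite eq_le.
apply/andP; split; apply: (il_le IL) => t Dt.
- exact: f0.
- by rewrite fg.
- by rewrite -fg// f0.
- by rewrite -fg.
Qed.

Lemma il_ge0 f : (forall t, D t -> 0 <= f t) -> 0 <= I f.
Proof.
move=> f0; rewrite -(mul0e (I (cst 1))) -(il_Z IL)//.
by apply: (il_le IL) => t Dt; rewrite mul0e// f0.
Qed.

Lemma il_cst (c : R) : (0 <= c)%R -> I (cst c%:E) = c%:E.
Proof.
move=> c0; rewrite -[RHS]mule1 -(il_1 IL) -(il_Z IL)//.
by apply: (congr1 I); apply/funext => t/=; rewrite mule1.
Qed.

Lemma il_sum (J : Type) (s : seq J) (f : J -> T -> \bar R) :
  (forall j, measurable_fun setT (f j)) -> (forall j t, 0 <= f j t) ->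
  I (fun t => \sum_(j <- s) f j t) = \sum_(j <- s) I (f j).
Proof.
move=> mf f0; elim: s => [|j s IHs].
  rewrite big_nil -[RHS](il_cst (c := 0%R))//; apply: (congr1 I); apply/funext => t.
  by rewrite big_nil.
rewrite big_cons -IHs -(il_D IL)//.
- by apply: (congr1 I); apply/funext => t; rewrite big_cons.
- exact: emeasurable_sum.
- by move=> t; exact: sume_ge0.
Qed.

End integral_like_theory.

Section tint.
Context d (T : measurableType d) (D : set T) (I : (T -> \bar R) -> \bar R).
Hypothesis IL : integral_like D I.

Lemma measurable_cons_pair d' (U : measurableType d') m
    (f : (m.+1.-tuple T) * U -> \bar R) : measurable_fun setT f ->
  measurable_fun setT
    (fun x : T * (m.-tuple T * U) => f (cons_tuple x.1 x.2.1, x.2.2)).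
Proof.
move=> mf; apply: (measurableT_comp mf); apply/measurable_fun_pair => /=.
  apply: measurable_cons => //.
  exact: measurableT_comp measurable_fst measurable_snd.
exact: measurableT_comp measurable_snd measurable_snd.
Qed.

(** Induction on [m], the head coordinate being integrated innermost. [il_meas] of [I], with the
    tail as parameter, gives the measurability that the outer additivity requires; for [il_meas]
    itself the parameter is the tail paired with [u]. *)
Lemma integral_like_tint m :
  integral_like (tuples_in D m) (tint T I m).
Proof.
elim: m => [|m IHm].
  split=> //=.
  - by move=> f g _; apply; case.
  - move=> d' U f mf f0; apply: (measurableT_comp mf).
    by apply/measurable_fun_pair => //; exact: measurable_id.
have mI (f : m.+1.-tuple T -> \bar R) : measurable_fun setT f ->
    (forall v, 0 <= f v) ->
    measurable_fun setT (fun v : m.-tuple T => I (fun t => f (cons_tuple t v))).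
  move=> mf f0; apply: (il_meas IL
    (f := fun x : T * m.-tuple T => f (cons_tuple x.1 x.2))) => //.
  by apply: (measurableT_comp mf); exact: measurable_cons.
split=> /=.
- move=> f g f0 fg; apply: (il_le IHm) => v Dv.
    by apply: (il_ge0 IL) => t Dt; exact: (f0 _ (tuples_in_cons Dt Dv)).
  apply: (il_le IL) => t Dt; first exact: (f0 _ (tuples_in_cons Dt Dv)).
  exact: (fg _ (tuples_in_cons Dt Dv)).
- move=> c f c0 f0.
  have If0 v : tuples_in D m v -> 0 <= I (fun t => f (cons_tuple t v)).
    by move=> Dv; apply: (il_ge0 IL) => t Dt; exact: (f0 _ (tuples_in_cons Dt Dv)).
  rewrite -(il_Z IHm)//; apply/esym/(il_eq IHm) => v Dv.
    by rewrite mule_ge0// If0.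
  by rewrite (il_Z IL)// => t Dt; exact: (f0 _ (tuples_in_cons Dt Dv)).
- rewrite -[RHS](il_1 IHm); congr tint; apply/funext => v.
  exact: (il_1 IL).
- move=> f g mf mg f0 g0; rewrite -(il_D IHm).
  + congr tint; apply/funext => v.
    by rewrite (il_D IL)//; apply: measurableT_comp => //; exact: measurable_cons.
  + exact: mI.
  + exact: mI.
  + by move=> v; exact: (il_ge0 IL).
  + by move=> v; exact: (il_ge0 IL).
- move=> d' U f mf f0.
  apply: (il_meas IHm (f:= fun x => I (fun t => f (cons_tuple t x.1, x.2)))).
    apply: (il_meas IL (f := fun x : T * (m.-tuple T * U) =>
      f (cons_tuple x.1 x.2.1, x.2.2))) => //.
    exact: measurable_cons_pair.
  by move=> x; exact: (il_ge0 IL).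
Qed.

(** The constant [c] is general so that the induction can absorb into it the factor contributed by
    the head coordinate. *)
Lemma tint_prod m (c : R) (phi : T -> R) : (0 <= c)%R ->
  (forall t, D t -> (0 <= phi t)%R) -> I (EFin \o phi) \is a fin_num ->
  tint T I m (fun v => (c * \prod_(i < m) phi (tnth v i))%:E) =
  (c * fine (I (EFin \o phi)) ^+ m)%:E.
Proof.
move=> + phi0 fphi; have Iphi0 : (0 <= fine (I (EFin \o phi)))%R.
  by apply/fine_ge0/(il_ge0 IL) => t Dt; rewrite lee_fin phi0.
elim: m c => [|m IHm] c c0 /=; first by rewrite big_ord0 expr0.
rewrite exprS mulrA -IHm ?mulr_ge0//.
apply/esym/(il_eq (integral_like_tint m)) => v Dv.
  by rewrite lee_fin !mulr_ge0// prodr_ge0// => i _; exact/phi0/Dv.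
have pr0 : (0 <= \prod_(i < m) phi (tnth v i))%R.
  by rewrite prodr_ge0// => i _; exact/phi0/Dv.
transitivity (((c * \prod_(i < m) phi (tnth v i))%:E * I (EFin \o phi))).
  by rewrite -[I _]fineK// -EFinM mulrAC.
rewrite -(il_Z IL) ?mulr_ge0//.
apply: (congr1 I); apply/funext => t /=.
rewrite big_ord_recl tnth_cons_tuple0 -EFinM; congr EFin.
rewrite mulrAC -mulrA; congr (_ * (_ * _))%R.
by apply: eq_bigr => i _; rewrite tnth_cons_tupleS.
Qed.

Lemma tint_coord m (i : 'I_m) (phi : T -> R) :
  (forall t, D t -> (0 <= phi t)%R) -> I (EFin \o phi) \is a fin_num ->
  tint T I m (fun v => (phi (tnth v i))%:E) = I (EFin \o phi).
Proof.
move=> phi0 fphi; have Iphi0 : (0 <= fine (I (EFin \o phi)))%R.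
  by apply/fine_ge0/(il_ge0 IL) => t Dt; rewrite lee_fin phi0.
elim: m i => [[]//|m IHm i].
have [<-|/unlift_some[j -> _]] := eqVneq ord0 i.
  rewrite -[RHS]fineK// -[RHS](il_cst (integral_like_tint m))//=.
  congr tint; apply/funext => v /=; rewrite fineK//; exact: (congr1 I).
rewrite -(IHm j) /=; apply/esym/(il_eq (integral_like_tint m)) => v Dv.
  by rewrite lee_fin phi0.
rewrite -[LHS](il_cst IL) ?phi0//=; apply: (congr1 I).
by apply/funext => t /=; rewrite tnth_cons_tupleS.
Qed.

End tint.
End integral_like.

Section cube.
Context {R : realType}.
Implicit Types r l n : nat.

Lemma integral_like_cube r : integral_like (@unit_cube R r) (@cube_int R r).
Proof. exact: integral_like_tint integral_like_int01 r. Qed.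

Lemma integral_like_db r l : integral_like (@db_space R r l) (@db_int R r l).
Proof. exact: integral_like_tint (integral_like_cube r) l. Qed.

Lemma measurable_unit_cube r : measurable (@unit_cube R r).
Proof.
rewrite (_ : unit_cube r = \bigcap_(j : 'I_r) ((@tnth _ R ^~ j) @^-1` `[0, 1])).
  apply: fin_bigcap_measurable => // j _; rewrite -[X in measurable X]setTI.
  by apply: (measurable_tnth j) => //; exact: measurable_itv.
apply/seteqP; split => [t ct j _|t ct j]; first by rewrite /= in_itv/= ct.
by have := ct j I; rewrite /= in_itv.
Qed.

Lemma measurable_forall d (T : measurableType d) (I : finType)
    (A : I -> T -> bool) : (forall i, measurable_fun setT (A i)) ->
  measurable_fun setT (fun y => [forall i, A i y]).
Proof.
move=> mA; apply: (measurable_fun_bool true).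
rewrite (_ : _ `&` _ = \bigcap_(i in [set: I]) (setT `&` A i @^-1` [set true])).
  apply: fin_bigcap_measurable => [|i _]; first exact: finite_finset.
  by apply: mA.
apply/seteqP; split => [y [_ /forallP Ay] i _|y Ay]; first by split=> //; exact: Ay.
by split => //; apply/forallP => i; have [] := Ay i Logic.I.
Qed.

Lemma measurable_tle r (t : r.-tuple R) :
  measurable_fun setT (fun y : r.-tuple R => tle r y t).
Proof.
apply: (measurable_forall (A := fun j (y : r.-tuple R) => tnth y j <= tnth t j)).
by move=> j; apply: measurable_fun_ler => //; exact: measurable_tnth.
Qed.

Lemma measurable_nat_of_bool d (T : measurableType d) (A : T -> bool) :
  measurable_fun setT A -> measurable_fun setT (fun y => (A y)%:R : R).
Proof.
move=> mA; rewrite (_ : (fun y => _) = fun y => if A y then 1 else 0 : R).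
  exact: measurable_fun_ifT.
by apply/funext => y; case: (A y).
Qed.

Lemma int01_itv_le (lo hi : R) : lo <= hi ->
  (int01 (fun t => ((lo < t <= hi)%R%:R)%:E) <= (hi - lo)%:E)%E.
Proof.
move=> lohi; rewrite /int01 integral_mkcond.
apply: (@le_trans _ _ (\int[@lebesgue_measure R]_(t in setT) (\1_`]lo, hi] t)%:E)%E).
  apply: ge0_le_integral_nonmeas => t _; first exact: erestrict_ge0.
  rewrite patchE; case: ifPn => _; rewrite indicE mem_setE in_itv//=.
  by have : (0 <= ((lo < t <= hi)%R%:R : R)%:E)%E by rewrite lee_fin.
rewrite integral_indic//.
rewrite setIT; change (@lebesgue_measure R `]lo, hi]%classic <= (hi - lo)%:E)%E.
rewrite lebesgue_measure_itv/= lte_fin; case: ifPn => [_|]//.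
by rewrite lee_fin subr_ge0.
Qed.

End cube.

(** * Exponential moments under a density *)

(** From [1 - x <= expR (- x)] one gets [expR x <= 1 / (1 - x)], and [(1 + x + 2 * x ^+ 2) * (1 - x)
    = 1 + x ^+ 2 * (1 - 2 * x)]. *)
Lemma expR_le_quad (R : realType) (x : R) : x <= 1 / 2 ->
  expR x <= 1 + x + 2 * x ^+ 2.
Proof.
move=> x2; have x1 : 0 < 1 - x by lra.
have : 1 - x <= (expR x)^-1 by rewrite -expRN; apply: expR_ge1Dx.
rewrite -(ler_pM2l (expR_gt0 x)) mulfV ?gt_eqF ?expR_gt0// => h.
rewrite -(ler_pM2r x1); apply: le_trans h _.
have : 0 <= x ^+ 2 * (1 - 2 * x) by rewrite mulr_ge0 ?sqr_ge0//; lra.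
rewrite -subr_ge0 => h; rewrite -subr_ge0.
by apply: le_trans h _; rewrite le_eqVlt; apply/orP; left; apply/eqP; ring.
Qed.

Section density.
Context {R : realType} (r : nat) (p : r.-tuple R -> R).
Hypothesis mp : measurable_fun setT p.
Hypothesis p0 : forall y, 0 <= p y.
Hypothesis p1 : cube_int r (fun y => (p y)%:E) = 1%E.
Implicit Types (w : r.-tuple R -> R) (A : r.-tuple R -> bool).

Let ILc := @integral_like_cube R r.

Let p0E y : unit_cube r y -> (0 <= (p y)%:E)%E.
Proof. by rewrite lee_fin. Qed.

(** Expectation under the law of density [p]; for [w] bounded and nonnegative on the cube, [fine]
    loses nothing by [cube_int_mean]. *)
Definition mean w : R := fine (cube_int r (fun y => (p y * w y)%:E)).

Lemma cube_int_mean w (M : R) : (forall y, unit_cube r y -> 0 <= w y <= M) ->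
  cube_int r (fun y => (p y * w y)%:E) = (mean w)%:E.
Proof.
move=> wM; rewrite fineK// fin_numElt; apply/andP; split.
  apply: (@lt_le_trans _ _ 0%E) => //; apply: (il_ge0 ILc) => y cy.
  by rewrite lee_fin mulr_ge0//; case/andP: (wM _ cy).
apply: (@le_lt_trans _ _ (cube_int r (fun y => `|M|%:E * (p y)%:E)%E)).
  apply: (il_le ILc) => y cy; have /andP[w0 wy] := wM _ cy.
    by rewrite lee_fin mulr_ge0.
  rewrite -EFinM lee_fin mulrC ler_wpM2r//.
  exact: le_trans wy (ler_norm _).
by rewrite (il_Z ILc) ?p1 ?mule1 ?ltry//; exact: p0E.
Qed.

Lemma mean_ge0 w : (forall y, unit_cube r y -> 0 <= w y) -> 0 <= mean w.
Proof.
by move=> w0; apply/fine_ge0/(il_ge0 ILc) => y cy; rewrite lee_fin mulr_ge0// w0.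
Qed.

Lemma mean_le w w' (M : R) : (forall y, unit_cube r y -> 0 <= w y) ->
  (forall y, unit_cube r y -> w y <= w' y <= M) -> mean w <= mean w'.
Proof.
move=> w0 ww'; rewrite -lee_fin -(@cube_int_mean w M); last first.
  by move=> y cy; rewrite w0//=; case/andP: (ww' _ cy) => /le_trans; apply.
rewrite -(@cube_int_mean w' M); last first.
  by move=> y cy; case/andP: (ww' _ cy) => /(le_trans (w0 _ cy)) -> ->.
apply: (il_le ILc) => y cy; rewrite lee_fin.
  by rewrite mulr_ge0// w0.
by rewrite ler_wpM2l//; case/andP: (ww' _ cy).
Qed.

Lemma mean_cst (c : R) : 0 <= c -> mean (cst c) = c.
Proof.
move=> c0; rewrite /mean -[RHS]/(fine c%:E); congr fine.
rewrite -[RHS]mule1 -p1 -(il_Z ILc)//.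
by congr (cube_int r _); apply/funext => y; rewrite mulrC EFinM.
Qed.

Lemma meanZ (c : R) w : 0 <= c -> (forall y, unit_cube r y -> 0 <= w y <= 1) ->
  mean (fun y => c * w y) = c * mean w.
Proof.
move=> c0 w0; rewrite -[RHS]/(fine (c * mean w)%:E) EFinM -(cube_int_mean w0).
rewrite -(il_Z ILc)//; last first.
  by move=> y cy; rewrite lee_fin mulr_ge0//; case/andP: (w0 _ cy).
by congr fine; congr (cube_int r _); apply/funext => y; rewrite mulrCA EFinM.
Qed.

Lemma meanD w w' (M : R) : measurable_fun setT w -> measurable_fun setT w' ->
  (forall y, 0 <= w y <= M) -> (forall y, 0 <= w' y <= M) ->
  mean (fun y => w y + w' y) = mean w + mean w'.
Proof.
move=> mw mw' w0 w0'; apply: EFin_inj; rewrite EFinD.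
rewrite -(@cube_int_mean w M)// -(@cube_int_mean w' M)//.
rewrite -(@cube_int_mean _ (M + M)); last first.
  move=> y _; case/andP: (w0 y) => a b; case/andP: (w0' y) => c d.
  by rewrite addr_ge0// lerD.
rewrite -(il_D ILc); last 4 first.
- by apply/measurable_EFinP; exact: measurable_funM.
- by apply/measurable_EFinP; exact: measurable_funM.
- by move=> y; rewrite lee_fin mulr_ge0//; case/andP: (w0 y).
- by move=> y; rewrite lee_fin mulr_ge0//; case/andP: (w0' y).
by congr (cube_int r _); apply/funext => y; rewrite mulrDr EFinD.
Qed.

(** Union bound: [A] is covered by [r] slabs, one per coordinate. The Lebesgue measure of a slab is
    that of its one-dimensional section, at most [d], and [p] costs a factor [K]. *)
Lemma mean_width (K d : R) (lo hi : 'I_r -> R) A : 0 <= K ->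
  (forall y, unit_cube r y -> p y <= K) ->
  (forall i, lo i <= hi i <= lo i + d) ->
  (forall y, A y -> exists i, lo i < tnth y i <= hi i) ->
  mean (fun y => (A y)%:R) <= K * r%:R * d.
Proof.
move=> K0 pK lohi AE; pose B i (t : R) : R := ((lo i < t <= hi i)%R)%:R.
rewrite -lee_fin -(@cube_int_mean _ 1); last by move=> y _; case: (A y); rewrite ?lexx ler01.
have iB i : (0 <= int01 (EFin \o B i) <= d%:E)%E.
  apply/andP; split.
    by apply: (il_ge0 integral_like_int01) => t _; rewrite lee_fin.
  have /andP[lh hd] := lohi i; apply: le_trans (int01_itv_le lh) _.
  by rewrite lee_fin; lra.
have cB i : cube_int r (fun y => (B i (tnth y i))%:E) = int01 (EFin \o B i).
  apply: (tint_coord integral_like_int01) => //.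
  by have /andP[a b] := iB i; rewrite fin_real// (lt_le_trans _ a)// (le_lt_trans b)// ltry.
apply: (@le_trans _ _ (cube_int r (fun y => \sum_(i < r) (K%:E * (B i (tnth y i))%:E)))%E).
  apply: (il_le ILc) => y cy; first by rewrite lee_fin mulr_ge0.
  case Ay: (A y); last by rewrite mulr0 sume_ge0// => i _; rewrite -EFinM lee_fin mulr_ge0.
  have [i Bi] := AE _ Ay; rewrite (bigD1 i)//= /B Bi mulr1 mule1.
  rewrite -[leLHS]adde0 leeD ?lee_fin ?pK//.
  by apply: sume_ge0 => j _; rewrite -EFinM lee_fin mulr_ge0.
rewrite (il_sum ILc); last 2 first.
- move=> i; under eq_fun do rewrite -EFinM; apply/measurable_EFinP.
  apply: measurable_funM => //; apply: measurable_nat_of_bool.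
  apply: measurable_and.
    by apply: measurable_fun_ltr => //; exact: measurable_tnth.
  by apply: measurable_fun_ler => //; exact: measurable_tnth.
- by move=> i y; rewrite -EFinM lee_fin mulr_ge0.
have -> : (K * r%:R * d)%:E = (\sum_(i < r) (K * d)%:E)%E.
  by rewrite sumEFin sumr_const card_ord -[in RHS]mulr_natr mulrAC.
apply: lee_sum => i _; rewrite (il_Z ILc)//; last first.
  by move=> y _; rewrite lee_fin.
rewrite cB EFinM; apply: lee_pmul => //.
- by case/andP: (iB i).
- by case/andP: (iB i).
Qed.

(** With [q] the probability of [A], the left side is [1 + q * (expR s - 1)], at most
    [expR (q * (expR s - 1))]; then [expR_le_quad] applies. *)
Lemma mean_exp_le (s : R) A : measurable_fun setT A -> `|s| <= 1 / 2 ->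
  mean (fun y => expR (s * (A y)%:R)) <=
    expR (mean (fun y => (A y)%:R) * (s + 2 * s ^+ 2)).
Proof.
move=> mA s2; set q := mean (fun y => (A y)%:R).
have E y : expR (s * (A y)%:R) = expR s * (A y)%:R + (~~ A y)%:R.
  by case: (A y); rewrite ?mulr1 ?mulr0 ?addr0 ?add0r ?expR0.
have b01 (b : bool) : 0 <= (b%:R : R) <= 1 by case: b; rewrite ?lexx ler01.
have mA1 : measurable_fun setT (fun y => (A y)%:R : R) by exact: measurable_nat_of_bool.
have mA2 : measurable_fun setT (fun y => (~~ A y)%:R : R).
  by apply: measurable_nat_of_bool; exact: measurable_neg.
have qC : mean (fun y => (~~ A y)%:R) = 1 - q.
  apply/eqP; rewrite eq_sym subr_eq addrC -(@meanD _ _ 1)//; apply/eqP.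
  rewrite -[LHS](mean_cst ler01); congr mean; apply/funext => y /=.
  by case: (A y); rewrite ?addr0 ?add0r.
have -> : mean (fun y => expR (s * (A y)%:R)) = expR s * q + (1 - q).
  rewrite -qC -meanZ ?expR_ge0//; under [in LHS]eq_fun do rewrite E.
  rewrite (@meanD _ _ (expR s + 1))//; first by exact: measurable_funM.
    move=> y; have := expR_gt0 s; case: (A y); rewrite ?mulr1 ?mulr0; lra.
  move=> y; have := expR_gt0 s; case: (A y); rewrite /=; lra.
have q0 : 0 <= q by apply: mean_ge0.
apply: (@le_trans _ _ (1 + q * (expR s - 1))); first by lra.
apply: le_trans (expR_ge1Dx _) _; rewrite ler_expR ler_wpM2l//.
have s2' : s <= 1 / 2 by exact: le_trans (ler_norm _) s2.
have := expR_le_quad s2'; lra.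
Qed.

(** Chernoff estimate for a sample: the exponential moment factorizes over the points, the terms
    linear in [s] cancel by centering, and [v] replaces [q] in the quadratic term. Both signs of [s]
    are allowed, for two-sided deviations. *)
Lemma tail_le n (s c v : R) A : measurable_fun setT A -> `|s| <= 1 / 2 ->
  let q := mean (fun y => (A y)%:R) in q <= v ->
  (db_int r n (fun x => (\prod_(i < n) p (tnth x i) *
     expR (s * (\sum_(i < n) (A (tnth x i))%:R - n%:R * q) - c))%:E) <=
   (expR (2 * n%:R * v * s ^+ 2 - c))%:E)%E.
Proof.
move=> mA s2 q qv; pose phi y := p y * expR (s * (A y)%:R).
have phiM : cube_int r (EFin \o phi) = (mean (fun y => expR (s * (A y)%:R)))%:E.
  apply: (@cube_int_mean _ (expR `|s|)) => y _; rewrite expR_ge0/= ler_expR.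
  by case: (A y); rewrite ?mulr1 ?mulr0 ?ler_norm.
rewrite (_ : (fun x => _) = fun x : n.-tuple (r.-tuple R) =>
    (expR (- s * n%:R * q - c) * \prod_(i < n) phi (tnth x i))%:E); last first.
  apply/funext => x; congr EFin; rewrite big_split/= mulrCA; congr (_ * _).
  rewrite -expR_sum -expRD -mulr_sumr; congr expR; ring.
have -> : db_int r n = tint _ (cube_int r) n by [].
rewrite (tint_prod ILc) ?expR_ge0//; last 2 first.
- by move=> y _; rewrite mulr_ge0// expR_ge0.
- by rewrite phiM.
rewrite lee_fin phiM/=.
apply: (@le_trans _ _ (expR (- s * n%:R * q - c) * expR (q * (s + 2 * s ^+ 2)) ^+ n)).
  rewrite ler_wpM2l ?expR_ge0// lerXn2r ?nnegrE ?expR_ge0//.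
    by apply: mean_ge0 => y _; exact: expR_ge0.
  exact: mean_exp_le.
rewrite -expRM_natl -expRD ler_expR.
have : 0 <= (v - q) * s ^+ 2 * n%:R.
  by rewrite mulr_ge0// mulr_ge0 ?sqr_ge0// subr_ge0.
lra.
Qed.

End density.

(** * Chaining over dyadic grids *)

Section chaining.
Context {R : realType} (r : nat).
Implicit Types (a b : 'I_r -> nat) (y t : r.-tuple R).

Lemma tle_trans : transitive (@tle R r).
Proof.
move=> y x z /forallP xy /forallP yz; apply/forallP => i.
exact: le_trans (xy i) (yz i).
Qed.

Definition grid j a : r.-tuple R := [tuple (a i)%:R / 2 ^+ j | i < r].

Lemma tle_grid_half j a : tle r (grid j (fun i => (a i)./2)) (grid j.+1 a).
Proof.
apply/forallP => i; rewrite !tnth_mktuple exprS invfM mulrA ler_pM2r ?invr_gt0 ?exprn_gt0//.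
rewrite ler_pdivlMr// -natrM ler_nat; lia.
Qed.

Lemma tle_grid j a b : (forall i, (a i <= b i)%N) -> tle r (grid j a) (grid j b).
Proof.
move=> ab; apply/forallP => i; rewrite !tnth_mktuple.
by rewrite ler_pM2r ?invr_gt0 ?exprn_gt0// ler_nat.
Qed.

(* The orthant below [grid J a] is the disjoint union over [j <= J] of the sets
   [layer j (fun i => a i %/ 2 ^ (J - j))]. *)
Definition layer j a y : bool :=
  if j is j'.+1 then tle r y (grid j a) && ~~ tle r y (grid j' (fun i => (a i)./2))
  else tle r y (grid 0 a).

Lemma measurable_layer j a : measurable_fun setT (layer j a).
Proof.
case: j => [|j]; first exact: measurable_tle.
apply: measurable_and; first exact: measurable_tle.
by apply: measurable_neg; exact: measurable_tle.
Qed.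

Lemma tle_layerS j a y : (tle r y (grid j.+1 a))%:R =
  (tle r y (grid j (fun i => (a i)./2)))%:R + (layer j.+1 a y)%:R :> R.
Proof.
rewrite /layer; case h: (tle r y (grid j _)); last by rewrite andbT add0r.
by rewrite (tle_trans h (tle_grid_half j a)) addr0.
Qed.

Lemma ecdfE l (u : l.-tuple (r.-tuple R)) t :
  ecdf r l u t = (\sum_(i < l) (tle r (tnth u i) t)%:R) / l%:R.
Proof.
rewrite /ecdf -sum1_card natr_sum; congr (_ / _).
rewrite big_mkcond/=; apply: eq_bigr => i _.
by rewrite unfold_in /in_set asboolb; case: (tle _ _ _).
Qed.

Lemma ecdf_bound l (u : l.-tuple (r.-tuple R)) t : 0 <= ecdf r l u t <= 1.
Proof.
(* For [l = 0] the convention [0^-1 = 0] makes the value 0. *)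
rewrite /ecdf divr_ge0//=; case: l u => [|l] u; first by rewrite invr0 mulr0.
rewrite ler_pdivrMr// mul1r ler_nat.
by apply: leq_trans (max_card _) _; rewrite card_ord.
Qed.

Lemma ecdf_le l (u : l.-tuple (r.-tuple R)) t t' : tle r t t' ->
  ecdf r l u t <= ecdf r l u t'.
Proof.
move=> tt'; rewrite !ecdfE ler_wpM2r// ler_sum// => i _.
by rewrite ler_nat; case h: (tle _ _ t) => //; rewrite (tle_trans h tt').
Qed.

Lemma unit_cube0 : unit_cube r [tuple (0 : R) | i < r].
Proof. by move=> i; rewrite tnth_mktuple lexx ler01. Qed.

Lemma KS_le (F G : r.-tuple R -> R) (c : R) :
  (forall t, unit_cube r t -> `|F t - G t| <= c) -> KS r F G <= c.
Proof.
move=> FG; apply: ge_sup; first by eexists; exists [tuple 0 | i < r] => //; exact: unit_cube0.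
by move=> _ [t ct <-]; exact: FG.
Qed.

(** The bounds on [F] and [G] make the set of distances bounded above, so that [sup] is a genuine
    supremum. *)
Lemma le_KS (F G : r.-tuple R -> R) t :
  (forall t, 0 <= F t <= 1) -> (forall t, 0 <= G t <= 1) ->
  unit_cube r t -> `|F t - G t| <= KS r F G.
Proof.
move=> F1 G1 ct; apply: ub_le_sup; last by exists t.
exists 1 => _ [t' _ <-]; have := F1 t'; have := G1 t'.
by rewrite ler_norml; lra.
Qed.

Lemma KS_triangle (F G H : r.-tuple R -> R) :
  (forall t, 0 <= F t <= 1) -> (forall t, 0 <= G t <= 1) ->
  (forall t, 0 <= H t <= 1) -> KS r F H <= KS r F G + KS r G H.
Proof.
move=> F1 G1 H1; apply: KS_le => t ct.
rewrite -(subrKA (G t)); apply: le_trans (ler_normD _ _) _.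
by rewrite lerD// le_KS.
Qed.

Lemma KSC (F G : r.-tuple R -> R) : KS r F G = KS r G F.
Proof.
rewrite /KS; congr sup; apply/seteqP.
by split => _ [t ct <-]; exists t => //; rewrite distrC.
Qed.

Variables (p : r.-tuple R -> R) (K : R).
Hypothesis mp : measurable_fun setT p.
Hypothesis p0 : forall y, 0 <= p y.
Hypothesis p1 : cube_int r (fun y => (p y)%:E) = 1%E.
Hypothesis K0 : 0 <= K.
Hypothesis pK : forall y, unit_cube r y -> p y <= K.

Let F := cdf_of_density r p.
Let prob (A : r.-tuple R -> bool) := mean p (fun y => (A y)%:R).

Let b01 (b : bool) : 0 <= (b%:R : R) <= 1.
Proof. by case: b; rewrite ?lexx ler01. Qed.

Lemma cdf_bound t : 0 <= F t <= 1.
Proof.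
apply/andP; split; first by apply: mean_ge0 => // y _; case/andP: (b01 (tle r y t)).
rewrite -[leRHS](mean_cst p0 p1 ler01); apply: (mean_le p0 p1 (M := 1)) => // y _.
by rewrite /cst; case/andP: (b01 (tle r y t)) => _ ->; rewrite lexx.
Qed.

Lemma cdfB t t' : tle r t t' ->
  F t' = F t + prob (fun y => tle r y t' && ~~ tle r y t).
Proof.
move=> tt'; rewrite /F /cdf_of_density /prob -[fine _]/(mean p _) -[fine _]/(mean p _).
rewrite -(meanD mp p0 p1 (M := 1))//; last 2 first.
- by apply: measurable_nat_of_bool; exact: measurable_tle.
- apply: measurable_nat_of_bool; apply: measurable_and; first exact: measurable_tle.
  by apply: measurable_neg; exact: measurable_tle.
congr mean; apply/funext => y; case h: (tle r y t); last by rewrite andbT add0r.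
by rewrite (tle_trans h tt') addr0.
Qed.

Lemma prob_orthant_diff_le t t' d : (forall i, tnth t i <= tnth t' i <= tnth t i + d) ->
  prob (fun y => tle r y t' && ~~ tle r y t) <= K * r%:R * d.
Proof.
move=> tt'; apply: (mean_width p0 p1 (lo := tnth t) (hi := tnth t')) => // y.
move=> /andP[/forallP yt' /forallPn[i yt]]; exists i; rewrite yt' andbT.
by rewrite ltNge.
Qed.

(** Halving the indices moves each coordinate of a level [j.+1] corner down by 0 or [1 / 2 ^+ j.+1],
    according to parity. The summand 1 covers level 0, where only the trivial bound on a probability
    is used. *)
Lemma prob_layer_le j a : prob (layer j a) <= (K * r%:R + 1) / 2 ^+ j.
Proof.
have D0 : 0 <= K * r%:R by rewrite mulr_ge0.
case: j => [|j].
  have /andP[_ F1] := cdf_bound (grid 0 a).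
  rewrite expr0 divr1; apply: le_trans F1 _; lra.
rewrite mulrDl; apply: ler_wpDr; first by rewrite divr_ge0// exprn_ge0.
apply: prob_orthant_diff_le => i; rewrite !tnth_mktuple.
rewrite exprS invfM; set w := (2 ^+ j)^-1; have w0 : 0 < w by rewrite invr_gt0 exprn_gt0.
have -> : (a i)%:R = (odd (a i))%:R + (a i)./2%:R * 2 :> R.
  by rewrite -natrM -natrD muln2 odd_double_half.
have := b01 (odd (a i)); move: (odd _)%:R (_./2)%:R => e h /andP[e0 e1].
have := mulr_ge0 e0 (ltW w0); have : 0 <= (1 - e) * w by rewrite mulr_ge0 ?subr_ge0// ltW.
lra.
Qed.

Definition layer_dev n (x : n.-tuple (r.-tuple R)) j a : R :=
  (\sum_(i < n) (layer j a (tnth x i))%:R) / n%:R - prob (layer j a).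

(** The deviations of the successive layers add up, and the sum of [(3 / 4) ^+ i] over [i <= j] is
    [4 - 3 * (3 / 4) ^+ j]. *)
Lemma chaining_bound n (x : n.-tuple (r.-tuple R)) (c : R) J :
  (forall j a, (j <= J)%N -> (forall i, (a i <= 2 ^ j)%N) ->
    `|layer_dev x j a| <= c * (3 / 4) ^+ j) ->
  forall j a, (j <= J)%N -> (forall i, (a i <= 2 ^ j)%N) ->
    `|ecdf r n x (grid j a) - F (grid j a)| <= c * (4 - 3 * (3 / 4) ^+ j).
Proof.
move=> dev; elim=> [|j IHj] a jJ aj.
  have := dev 0%N a isT aj; rewrite /layer_dev -ecdfE !expr0.
  by rewrite (_ : c * (4 - 3 * 1) = c * 1)//; ring.
have IH := IHj (fun i => (a i)./2) (ltnW jJ).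
have {}IH : `|ecdf r n x (grid j (fun i => (a i)./2)) - F (grid j (fun i => (a i)./2))|
    <= c * (4 - 3 * (3 / 4) ^+ j).
  by apply: IH => i; have := aj i; rewrite expnS; lia.
have D := dev j.+1 a jJ aj.
have -> : ecdf r n x (grid j.+1 a) - F (grid j.+1 a) =
    (ecdf r n x (grid j (fun i => (a i)./2)) - F (grid j (fun i => (a i)./2)))
    + layer_dev x j.+1 a.
  rewrite (cdfB (tle_grid_half j a)) !ecdfE.
  under eq_bigr do rewrite tle_layerS.
  rewrite big_split/= /layer_dev mulrDl /layer; ring.
apply: le_trans (ler_normD _ _) _; apply: le_trans (lerD IH D) _.
by rewrite exprS; lra.
Qed.

(** A point [t] is bracketed by its lower and upper roundings [a] and [b] on the finest grid. Both
    functions are monotone, and [F] grows by at most the last term between the two corners. *)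
Lemma KS_chaining n (x : n.-tuple (r.-tuple R)) (c : R) J : 0 <= c ->
  (forall j a, (j <= J)%N -> (forall i, (a i <= 2 ^ j)%N) ->
    `|layer_dev x j a| <= c * (3 / 4) ^+ j) ->
  KS r F (ecdf r n x) <= 4 * c + K * r%:R / 2 ^+ J.
Proof.
move=> c0 dev; have G := chaining_bound dev (leqnn J).
have {}G a : (forall i, (a i <= 2 ^ J)%N) ->
    `|ecdf r n x (grid J a) - F (grid J a)| <= 4 * c.
  move=> aJ; apply: le_trans (G a aJ) _.
  have : 0 <= c * (3 / 4) ^+ J by rewrite mulr_ge0// exprn_ge0//; lra.
  lra.
have e0 : 0 < 2 ^+ J :> R by rewrite exprn_gt0.
apply: KS_le => t ct.
pose a i := Num.truncn (2 ^+ J * tnth t i).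
have a_itv i : (a i)%:R <= 2 ^+ J * tnth t i < (a i).+1%:R.
  by apply: truncn_itv; rewrite mulr_ge0 ?(ltW e0)//; case/andP: (ct i).
have aJ i : (a i <= 2 ^ J)%N.
  rewrite -(ler_nat R) natrX; have /andP[h _] := a_itv i; apply: le_trans h _.
  by rewrite ler_piMr ?(ltW e0)//; case/andP: (ct i).
(* The cap keeps the index in the range where [dev] applies; the corner still dominates [t] because
   [t] has coordinates at most 1. *)
pose b i := minn (a i).+1 (2 ^ J).
have bJ i : (b i <= 2 ^ J)%N by rewrite geq_minr.
have ab i : (a i <= b i)%N by rewrite leq_min leqnSn aJ.
have at_ : tle r (grid J a) t.
  apply/forallP => i; rewrite tnth_mktuple ler_pdivrMr// mulrC.
  by case/andP: (a_itv i).
have tb : tle r t (grid J b).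
  apply/forallP => i; rewrite tnth_mktuple ler_pdivlMr// mulrC /b.
  have /andP[_ /ltW h] := a_itv i.
  rewrite /minn; case: ifP => _ //; rewrite natrX ler_piMr ?(ltW e0)//.
  by case/andP: (ct i).
have Fab : F (grid J b) <= F (grid J a) + K * r%:R / 2 ^+ J.
  rewrite (cdfB (tle_grid J ab)) lerD2l; apply: prob_orthant_diff_le => i.
  rewrite !tnth_mktuple -[X in _ + X]mul1r -mulrDl !ler_pM2r ?invr_gt0//.
  by rewrite natr1 !ler_nat ab /b geq_minl.
have Fp s s' : tle r s s' -> F s <= F s'.
  by move=> ss'; rewrite (cdfB ss') lerDl; apply: mean_ge0 => // y _; case/andP: (b01 _).
have := G a aJ; have := G b bJ.
have := ecdf_le x at_; have := ecdf_le x tb; have := Fp _ _ at_; have := Fp _ _ tb.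
rewrite !ler_norml; lra.
Qed.

End chaining.

(** * Concentration of the empirical distribution function *)

Lemma bernoulli_ineq (R : realType) (d : R) j : 0 <= d ->
  1 + j%:R * d <= (1 + d) ^+ j.
Proof.
move=> d0; elim: j => [|j IHj]; first by rewrite mul0r addr0 expr0.
rewrite exprS; have : 0 <= 1 + d by lra.
move=> /(ler_wpM2l) /(_ _ _ IHj); apply: le_trans.
have : 0 <= j%:R * d * d by rewrite !mulr_ge0.
rewrite -natr1; lra.
Qed.

Lemma geometric_sum_le (R : realType) (u : R) m : 0 <= u <= 1 / 2 ->
  \sum_(j < m) u ^+ j.+1 <= 2 * u.
Proof.
(* The induction needs the sharper bound with [2 * u ^+ m.+1] subtracted. *)
move=> /andP[u0 u2]; apply: (@le_trans _ _ (2 * u - 2 * u ^+ m.+1)); last first.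
  by rewrite gerBl mulr_ge0// exprn_ge0.
elim: m => [|m IHm]; first by rewrite big_ord0 expr1 subrr.
rewrite big_ord_recr/=; apply: le_trans (lerD IHm (lexx _)) _.
rewrite (exprS _ m.+1); have : 0 <= u ^+ m.+1 by exact: exprn_ge0.
move: (u ^+ _) => w w0; have : 0 <= (1 - 2 * u) * w by rewrite mulr_ge0//; lra.
lra.
Qed.

Section concentration.
Context {R : realType} (r : nat) (p : r.-tuple R -> R) (K : R).
Hypothesis mp : measurable_fun setT p.
Hypothesis p0 : forall y, 0 <= p y.
Hypothesis p1 : cube_int r (fun y => (p y)%:E) = 1%E.
Hypothesis K0 : 0 <= K.
Hypothesis pK : forall y, unit_cube r y -> p y <= K.

Let D := K * r%:R + 1.

Let D_gt0 : 0 < D.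
Proof. by rewrite ltr_wpDl// mulr_ge0. Qed.

Section level.
Variables (n J : nat) (L : R).
Hypothesis L0 : 0 < L.
Hypothesis Jn : (4 ^ J <= n)%N.

Let n0 : 0 < n%:R :> R.
Proof. by rewrite ltr0n; apply: leq_trans Jn; rewrite expn_gt0. Qed.

(** Later [2 ^+ J] is of order the square root of [n]. The ratio [3 / 4] is below 1, so the widths
    are summable, while [(3 / 4) ^+ 2 * 2 > 1], so the Chernoff exponents grow with [j] and beat the
    number of grid points. *)
Definition dev_width j : R := L / 2 ^+ J * (3 / 4) ^+ j.
(* The optimal Chernoff parameter for deviations of size [dev_width j] of an
   event of probability at most [D / 2 ^+ j]. *)
Definition dev_tilt j : R := dev_width j * 2 ^+ j / (4 * D).

Definition dev_term j (a : 'I_r -> nat) (b : bool) (x : n.-tuple (r.-tuple R)) : R :=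
  expR ((-1) ^+ b * dev_tilt j *
    (\sum_(i < n) (layer j a (tnth x i))%:R
     - n%:R * mean p (fun y => (layer j a y)%:R))
    - dev_tilt j * n%:R * dev_width j).

(** A function in place of an exceptional event: a term reaches 1 as soon as its deviation reaches
    [dev_width j], so [dev_sum x < 1] excludes all large deviations at once. Bounding its integral
    does the work of Markov's inequality and the union bound together. *)
Definition dev_sum (x : n.-tuple (r.-tuple R)) : R :=
  \sum_(j < J.+1) \sum_(a : {ffun 'I_r -> 'I_(2 ^ j).+1}) \sum_(b : bool)
    dev_term j (fun i => a i) b x.

Let width_gt0 j : 0 < dev_width j.
Proof. by rewrite mulr_gt0 ?divr_gt0 ?exprn_gt0//; lra. Qed.

Let tilt_gt0 j : 0 < dev_tilt j.
Proof. by rewrite divr_gt0 ?mulr_gt0 ?exprn_gt0. Qed.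

Lemma dev_sum_ge0 x : 0 <= dev_sum x.
Proof. by do 3!(apply: sumr_ge0 => ? _); exact: expR_ge0. Qed.

Lemma measurable_dev_term j a b : measurable_fun setT (dev_term j a b).
Proof.
apply: measurableT_comp => //; apply: measurable_funB => //.
apply: measurable_funM => //; apply: measurable_funB => //.
apply: measurable_sum => i.
apply: (@measurableT_comp _ _ _ _ _ _ (fun y => (layer j a y)%:R : R) _
  (fun x : n.-tuple (r.-tuple R) => tnth x i)); last exact: measurable_tnth.
by apply: measurable_nat_of_bool; exact: measurable_layer.
Qed.

Lemma measurable_dev_sum : measurable_fun setT dev_sum.
Proof.
by do 3!(apply: measurable_sum => ?); exact: measurable_dev_term.
Qed.

Lemma dev_sum_KS x : dev_sum x < 1 ->
  KS r (cdf_of_density r p) (ecdf r n x) <= (4 * L + K * r%:R) / 2 ^+ J.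
Proof.
move=> S1; rewrite mulrDl -[4 * L / _]mulrA.
apply: (KS_chaining mp p0 p1) => //; first by rewrite divr_ge0 ?(ltW L0)// exprn_ge0.
move=> j a jJ aj; rewrite -/(dev_width j) /layer_dev.
pose a' := [ffun i => inord (a i) : 'I_(2 ^ j).+1].
have E : (fun i => nat_of_ord (a' i)) = a.
  by apply/funext => i; rewrite ffunE inordK// ltnS.
set X := \sum_(i < n) _; set q := mean p _.
(* All terms are nonnegative, so each is below 1 and its exponent is negative. The two values of [b]
   give the two sides of the absolute value. *)
have lt_dev (b : bool) : (-1) ^+ b * (X - n%:R * q) < n%:R * dev_width j.
  have : dev_term j a b x < 1.
    apply: le_lt_trans S1.
    have term_ge0 i f c : 0 <= dev_term i f c x by exact: expR_ge0.
    rewrite /dev_sum (bigD1 (Ordinal (jJ : (j < J.+1)%N)))//=.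
    rewrite (bigD1 a')//= (bigD1 b)//= E -!addrA lerDl.
    rewrite addr_ge0 ?sumr_ge0// addr_ge0 ?sumr_ge0// => ? _; rewrite ?sumr_ge0// => ? _.
    by rewrite sumr_ge0.
  rewrite /dev_term -/X -/q -[X in _ < X]expR0 ltr_expR subr_lt0 => h.
  by rewrite -(ltr_pM2l (tilt_gt0 j)); move: h; lra.
have h0 := lt_dev false; have h1 := lt_dev true.
rewrite expr0 mul1r in h0; rewrite expr1 mulN1r in h1.
have -> : X / n%:R - q = (X - n%:R * q) / n%:R.
  by rewrite mulrBl mulrAC divff ?mul1r ?gt_eqF.
rewrite normrM normfV (gtr0_norm n0) ler_pdivrMr// ler_norml mulrC; lra.
Qed.

Let card_le_expR (j : nat) :
  #|{: {ffun 'I_r -> 'I_(2 ^ j).+1}}|%:R <= expR (r%:R * j.+1%:R) :> R.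
Proof.
have e2 : 2 <= expR 1 :> R by apply: le_trans (expR_ge1Dx _); lra.
have -> : expR (r%:R * j.+1%:R) = (expR 1 ^+ j.+1) ^+ r :> R.
  by rewrite -exprM -expRM_natl mulr1 natrM mulrC.
rewrite card_ffun !card_ord natrX; apply: lerXn2r; rewrite ?nnegrE ?exprn_ge0 ?expR_ge0//.
apply: (@le_trans _ _ (2 ^+ j.+1)).
  rewrite -natrX ler_nat expnS; have : (0 < 2 ^ j)%N by rewrite expn_gt0.
  lia.
by apply: lerXn2r; rewrite ?nnegrE ?expR_ge0.
Qed.

(** The chosen tilt leaves the exponent [- (n * w ^+ 2 * 2 ^+ j / (8 * D))]. Since [4 ^ J <= n], the
    product [n * w ^+ 2 * 2 ^+ j] is at least [L ^+ 2 * (9 / 8) ^+ j], hence at least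
    [L ^+ 2 * (1 + j / 8)] by Bernoulli; the factor 64 is 8 from here times 8 from the exponent. *)
Lemma dev_term_le (rho : R) j a b :
  dev_tilt j <= 1 / 2 -> 64 * D * rho <= L ^+ 2 -> 0 <= rho ->
  (db_int r n (fun x => (\prod_(i < n) p (tnth x i) * dev_term j a b x)%:E) <=
   (expR (- (rho * j.+1%:R)))%:E)%E.
Proof.
move=> t2 rhoL rho0; set s := dev_tilt j; set w := dev_width j.
have ns : `|(-1) ^+ b * s| <= 1 / 2.
  by rewrite normrMsign (gtr0_norm (tilt_gt0 j)).
have := tail_le mp p0 p1 n (s * n%:R * w) (measurable_layer j a) ns
  (prob_layer_le p0 p1 K0 pK j a).
move=> /le_trans; apply; rewrite lee_fin ler_expR exprMn sqrr_sign mul1r -/D.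
have e2 : 0 < 2 ^+ j :> R by rewrite exprn_gt0.
have -> : 2 * n%:R * (D / 2 ^+ j) * s ^+ 2 - s * n%:R * w =
    - (n%:R * w ^+ 2 * 2 ^+ j / (8 * D)).
  rewrite /s /dev_tilt -/w; field.
  by rewrite !gt_eqF.
rewrite lerN2 ler_pdivlMr ?mulr_gt0//.
have eJ : 0 < 2 ^+ J :> R by rewrite exprn_gt0.
have h1 : L ^+ 2 <= n%:R * (L / 2 ^+ J) ^+ 2.
  rewrite exprMn mulrCA -[leLHS]mulr1 ler_wpM2l ?sqr_ge0//.
  rewrite exprVn -exprM mulnC exprM ler_pdivlMr ?exprn_gt0// mul1r.
  by rewrite -!natrX ler_nat.
have h2 : 1 + j%:R * (1 / 8) <= ((3 / 4) ^+ j) ^+ 2 * 2 ^+ j :> R.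
  rewrite -exprM mulnC exprM -exprMn; apply: le_trans (bernoulli_ineq _ _) _; first lra.
  by rewrite (_ : (3 / 4) ^+ 2 * 2 = 1 + 1 / 8 :> R)//; lra.
rewrite {1}/w /dev_width exprMn.
apply: (@le_trans _ _ (L ^+ 2 * (1 + j%:R * (1 / 8)))).
  apply: (@le_trans _ _ (64 * D * rho * (1 + j%:R * (1 / 8)))).
    have z0 : 0 <= D * rho by rewrite mulr_ge0 ?(ltW D_gt0).
    have zj : 0 <= D * rho * j%:R by rewrite mulr_ge0.
    rewrite -natr1; lra.
  by rewrite ler_wpM2r// addr_ge0// mulr_ge0//; lra.
rewrite [X in X * _ ^+ j]mulrA -[leRHS]mulrA; apply: ler_pM => //; first exact: sqr_ge0.
Qed.

(** With rate [r%:R - ln u], the at most [expR (r * j.+1)] corners of level [j] contribute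
    [2 * u ^+ j.+1] in total, the 2 counting the signs. *)
Lemma dev_sum_le (u : R) : 0 < u <= 1 / 2 -> 64 * D * (r%:R - ln u) <= L ^+ 2 ->
  (forall j, (j <= J)%N -> dev_tilt j <= 1 / 2) ->
  (db_int r n (fun x => (\prod_(i < n) p (tnth x i) * dev_sum x)%:E) <=
   (4 * u)%:E)%E.
Proof.
move=> /andP[u0 u2] uL t2.
have rho0 : 0 <= r%:R - ln u.
  by rewrite subr_ge0 (@le_trans _ _ 0)// ln_le0//; lra.
pose P (x : n.-tuple (r.-tuple R)) := \prod_(i < n) p (tnth x i).
have P0 x : 0 <= P x by exact: prodr_ge0.
have mP : measurable_fun setT P.
  apply: measurable_prod => i _.
  by apply: (measurableT_comp mp); exact: measurable_tnth.
pose f j a b x := (P x * dev_term j a b x)%:E.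
have f0 j a b x : (0 <= f j a b x)%E by rewrite lee_fin mulr_ge0// expR_ge0.
have mf j a b : measurable_fun setT (f j a b).
  apply/measurable_EFinP; apply: measurable_funM => //; exact: measurable_dev_term.
have ILd := @integral_like_db R r n.
rewrite (_ : (fun x => _) = fun x => (\sum_(j < J.+1)
    \sum_(a : {ffun 'I_r -> 'I_(2 ^ j).+1}) \sum_(b : bool)
      f j (fun i => a i) b x)%E); last first.
  apply/funext => x; rewrite /dev_sum mulr_sumr -sumEFin; apply: eq_bigr => j _.
  rewrite mulr_sumr -sumEFin; apply: eq_bigr => a _.
  by rewrite mulr_sumr -sumEFin.
rewrite (il_sum ILd); last 2 first.
- by move=> j; do 2!(apply: emeasurable_sum => ?).
- by move=> j x; do 2!(apply: sume_ge0 => ? _).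
apply: (@le_trans _ _ (\sum_(j < J.+1) (2 * u ^+ j.+1)%:E)%E); last first.
  rewrite sumEFin lee_fin -mulr_sumr -[leRHS]/(4 * u) (_ : 4 * u = 2 * (2 * u)); last ring.
  by rewrite ler_pM2l// geometric_sum_le// (ltW u0).
apply: lee_sum => j _; rewrite (il_sum ILd); last 2 first.
- by move=> a; apply: emeasurable_sum => ?.
- by move=> a x; apply: sume_ge0 => ? _.
apply: (@le_trans _ _ (\sum_(a : {ffun 'I_r -> 'I_(2 ^ j).+1})
    (2 * expR (- ((r%:R - ln u) * j.+1%:R)))%:E)%E).
  apply: lee_sum => a _; rewrite (il_sum ILd)// big_bool/= mulrDl mul1r EFinD.
  by apply: leeD; apply: dev_term_le => //; apply: t2; rewrite -ltnS.
rewrite sumEFin lee_fin sumr_const -[leLHS]mulr_natl mulrCA ler_pM2l//.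
apply: le_trans (ler_wpM2r (expR_ge0 _) (card_le_expR j)) _.
by rewrite -expRD mulrBl opprB addrCA subrr addr0 mulrC expRM_natl lnK ?posrE.
Qed.

End level.

Lemma ecdf_concentration (eta : R) : 0 < eta -> exists (L : R) (J0 : nat),
  0 < L /\ forall J n, (J0 <= J)%N -> (4 ^ J <= n)%N ->
  exists S : n.-tuple (r.-tuple R) -> R,
    [/\ measurable_fun setT S, forall x, 0 <= S x,
      (db_int r n (fun x => (\prod_(i < n) p (tnth x i) * S x)%:E) <= eta%:E)%E &
      forall x, S x < 1 -> KS r (cdf_of_density r p) (ecdf r n x) <= L / 2 ^+ J].
Proof.
move=> eta0; pose u : R := Num.min (1 / 2) (eta / 4).
have u0 : 0 < u by rewrite lt_min; apply/andP; split; [lra|rewrite divr_gt0].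
have u2 : u <= 1 / 2 by rewrite ge_min lexx.
have u4 : 4 * u <= eta.
  have : u <= eta / 4 by rewrite ge_min lexx orbT.
  lra.
(* Adding 1 ensures [1 <= L], so that [L <= L ^+ 2] gives the condition of [dev_sum_le]. *)
pose L := 64 * D * (r%:R - ln u) + 1.
have rho0 : 0 <= D * (r%:R - ln u).
  rewrite mulr_ge0 ?(ltW D_gt0)// subr_ge0 (@le_trans _ _ 0)// ln_le0//; lra.
have L1 : 1 <= L by rewrite /L -mulrA lerDr mulr_ge0.
have L0 : 0 < L by lra.
(* The first witness comes from [dev_sum_KS]. The second forces [3 * L <= J], so that
   [L <= 2 * (4 / 3) ^+ J] by Bernoulli; the tilt, largest at [j = J] with value
   [L * (3 / 4) ^+ J / (4 * D)], is then at most [1 / 2]. *)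
exists (4 * L + K * r%:R), (Num.truncn (3 * L)).+1; split.
  by rewrite ltr_wpDr ?mulr_ge0// mulr_gt0.
move=> J n JJ Jn; exists (dev_sum J L); split.
- exact: measurable_dev_sum.
- exact: dev_sum_ge0.
- apply: le_trans (_ : ((4 * u)%:E <= _)%E); last by rewrite lee_fin.
  apply: dev_sum_le => //; first by rewrite u0.
    have : L <= L ^+ 2 by rewrite expr2 ler_peMl// ltW.
    by apply: le_trans; rewrite /L; lra.
  move=> j jJ; rewrite /dev_tilt /dev_width.
  have eJ : 0 < 2 ^+ J :> R by rewrite exprn_gt0.
  have LJ : L <= 2 * (4 / 3) ^+ J.
    have := bernoulli_ineq J (_ : 0 <= 1 / 3 :> R).
    rewrite (_ : 1 + 1 / 3 = 4 / 3 :> R); last by field.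
    have := truncnS_gt (3 * L); rewrite -(ler_nat R) in JJ; lra.
  have D1 : 1 <= D by rewrite lerDr mulr_ge0.
  rewrite ler_pdivrMr ?mulr_gt0// -mulrA -exprMn.
  apply: (@le_trans _ _ (L / 2 ^+ J * (3 / 4 * 2) ^+ J)).
    rewrite ler_pM2l ?divr_gt0// ler_weXn2l//; lra.
  rewrite exprMn mulrA mulrAC divfK ?gt_eqF//.
  apply: (@le_trans _ _ (2 * (4 / 3) ^+ J * (3 / 4) ^+ J)).
    by rewrite ler_wpM2r// exprn_ge0//; lra.
  rewrite -mulrA -exprMn (_ : 4 / 3 * (3 / 4) = 1 :> R) ?expr1n; first lra.
  by field.
- exact: dev_sum_KS.
Qed.

End concentration.

(** * Sensitivity of the Kolmogorov-Smirnov distance *)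

Section sensitivity.
Context {R : realType} (r : nat).

Lemma KS_ecdf_hamming n (x y : n.-tuple (r.-tuple R)) :
  KS r (ecdf r n x) (ecdf r n y) <= (hamming r n x y)%:R / n%:R.
Proof.
have hE : (hamming r n x y)%:R = \sum_(i < n) (tnth x i != tnth y i)%:R :> R.
  rewrite /hamming -sum1_card natr_sum big_mkcond/=; apply: eq_bigr => i _.
  by rewrite unfold_in /in_set asboolb; case: (_ != _).
apply: KS_le => t _; rewrite !ecdfE -mulrBl normrM normfV normr_nat.
rewrite ler_wpM2r// hE -sumrB; apply: le_trans (ler_norm_sum _ _ _) _.
apply: ler_sum => i _; have [->|_] := eqVneq; first by rewrite subrr normr0.
by case: (tle _ _ _); case: (tle _ _ _); rewrite ?subrr ?subr0 ?sub0r ?normrN ?normr0 ?normr1.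
Qed.

Lemma sensitivity_KS_le n k (x y : n.-tuple (r.-tuple R)) (z : k.-tuple (r.-tuple R)) :
  hamming r n x y = 1%N ->
  `|KS r (ecdf r n x) (ecdf r k z) - KS r (ecdf r n y) (ecdf r k z)| <= n%:R^-1.
Proof.
move=> xy; have := KS_ecdf_hamming x y; rewrite xy mul1r => h.
have Fx := ecdf_bound x; have Fy := ecdf_bound y; have Fz := ecdf_bound z.
have := KS_triangle Fx Fy Fz; have := KS_triangle Fy Fx Fz.
by rewrite (KSC (ecdf r n y) (ecdf r n x)) ler_norml; lra.
Qed.

Lemma ecdf_const l (c t : r.-tuple R) : (0 < l)%N ->
  ecdf r l [tuple c | i < l] t = (tle r c t)%:R.
Proof.
move=> l0; rewrite ecdfE; under eq_bigr do rewrite tnth_mktuple.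
by rewrite sumr_const card_ord -[_ *+ _]mulr_natr mulfK// pnatr_eq0 -lt0n.
Qed.

(* Moving a single point of the database from the corner 0 to the corner 1 changes
   by 1/n the distance to a synthetic sample concentrated at the corner 1. *)
Lemma sensitivity_KS n k : (0 < r)%N -> (0 < n)%N -> (0 < k)%N ->
  0 < sensitivity (R := R) r n k (KS r) <= n%:R^-1.
Proof.
move=> r0 n0 k0; pose zero : r.-tuple R := [tuple 0 | i < r].
pose one : r.-tuple R := [tuple 1 | i < r].
have c1 : unit_cube r one by move=> i; rewrite tnth_mktuple lexx ler01.
have c0 : unit_cube r zero := @unit_cube0 R r.
have n0' : 0 < n%:R :> R by rewrite ltr0n.
have one_zero : one != zero.
  apply/eqP => /(congr1 (fun t => tnth t (Ordinal r0))).
  by rewrite !tnth_mktuple => /eqP; rewrite oner_eq0.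
pose i0 := Ordinal n0.
pose x : n.-tuple (r.-tuple R) := [tuple zero | i < n].
pose y : n.-tuple (r.-tuple R) := [tuple if i == i0 then one else zero | i < n].
pose z : k.-tuple (r.-tuple R) := [tuple one | i < k].
have dx : db_space r n x by move=> i; rewrite tnth_mktuple.
have dy : db_space r n y by move=> i; rewrite tnth_mktuple; case: ifP.
have dz : db_space r k z by move=> i; rewrite tnth_mktuple.
have xy : hamming r n x y = 1%N.
  rewrite /hamming (eq_card (B := pred1 i0)) ?card1// => i.
  rewrite unfold_in /in_set asboolb !tnth_mktuple inE; case: (i == i0).
    by rewrite eq_sym one_zero.
  by rewrite eqxx.
pose S := [set d : R | exists (x y : n.-tuple (r.-tuple R)) (z : k.-tuple (r.-tuple R)),
        [/\ db_space r n x, db_space r n y, hamming r n x y = 1%N, db_space r k z &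
            d = `|KS r (ecdf r n x) (ecdf r k z) - KS r (ecdf r n y) (ecdf r k z)|] ].
have Sub : ubound S n%:R^-1.
  by move=> _ [x' [y' [z' [_ _ h _ ->]]]]; exact: sensitivity_KS_le.
pose d := `|KS r (ecdf r n x) (ecdf r k z) - KS r (ecdf r n y) (ecdf r k z)|.
have Sd : S d by exists x, y, z.
rewrite (_ : sensitivity _ _ _ _ = sup S)//; apply/andP; split; last first.
  by apply: ge_sup => //; exists d.
apply: (@lt_le_trans _ _ d); last by apply: ub_le_sup => //; exists n%:R^-1.
have Ex t : ecdf r n x t = (tle r zero t)%:R := ecdf_const zero t n0.
have Ez t : ecdf r k z t = (tle r one t)%:R := ecdf_const one t k0.
have zero_zero : tle r zero zero by apply/forallP => i; exact: lexx.
have zero_one : tle r one zero = false.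
  apply/negbTE/forallPn; exists (Ordinal r0); rewrite !tnth_mktuple.
  by rewrite -ltNge ltr01.
have KSx : 1 <= KS r (ecdf r n x) (ecdf r k z).
  apply: le_trans (le_KS (ecdf_bound x) (ecdf_bound z) c0).
  by rewrite Ex Ez zero_zero zero_one subr0 normr1.
(* At a point [t] of the cube, either [t] dominates the corner 1 and both functions equal 1, or
   [ecdf r k z t = 0] and only the point [i0] of [y] is missed. *)
have KSy : KS r (ecdf r n y) (ecdf r k z) <= 1 - n%:R^-1.
  apply: KS_le => t ct.
  have zt : tle r zero t.
    by apply/forallP => i; rewrite tnth_mktuple; case/andP: (ct i).
  have n1 : 0 <= 1 - n%:R^-1 :> R by rewrite subr_ge0 invf_le1// ler1n.
  rewrite Ez ecdfE (bigD1 i0)//= tnth_mktuple eqxx.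
  rewrite (eq_bigr (fun=> 1)) => [|i /negbTE ii0]; last by rewrite tnth_mktuple ii0 zt.
  rewrite sumr_const cardC1 card_ord -subn1 natrB//.
  case: (tle r one t); first by rewrite addrC subrK divff ?gt_eqF// subrr normr0.
  by rewrite add0r subr0 mulrBl divff ?gt_eqF// mul1r ger0_norm.
have : 0 < n%:R^-1 :> R by rewrite invr_gt0.
rewrite /d => h; rewrite gtr0_norm; lra.
Qed.

End sensitivity.

(** * The exponential mechanism *)

Section mechanism.
Context {R : realType} (r : nat) (p : r.-tuple R -> R) (K : R).
Hypothesis mp : measurable_fun setT p.
Hypothesis p0 : forall y, 0 <= p y.
Hypothesis p1 : cube_int r (fun y => (p y)%:E) = 1%E.
Hypothesis K0 : 0 < K.
Hypothesis pK : forall y, unit_cube r y -> p y <= K.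

Let F := cdf_of_density r p.
Let weight n (x : n.-tuple (r.-tuple R)) := \prod_(i < n) p (tnth x i).

Let weight_ge0 n (x : n.-tuple (r.-tuple R)) : 0 <= weight x.
Proof. exact: prodr_ge0. Qed.

Let measurable_weight n : measurable_fun setT (@weight n).
Proof.
apply: measurable_prod => i _.
by apply: (measurableT_comp mp); exact: measurable_tnth.
Qed.

Lemma db_int_weight n : db_int r n (fun x => (weight x)%:E) = 1%E.
Proof.
have p1' : cube_int r (EFin \o p) = 1%E := p1.
have := tint_prod (integral_like_cube r) n ler01 (fun y _ => p0 y).
rewrite p1' => /(_ isT); rewrite /= expr1n mulr1 => <-.
by congr (db_int r n _); apply/funext => x; rewrite mul1r.
Qed.

(** Take for [J] the integer logarithm of [n] in base 4: [n < 4 ^ J.+1] bounds the square root of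
    [n] by [2 ^+ J.+1], whence the factor 2 on [L]. *)
Lemma ecdf_concentration_sqrt (eta : R) : 0 < eta ->
  exists (L : R) (N : nat), 0 < L /\ forall n, (N <= n)%N ->
  exists S : n.-tuple (r.-tuple R) -> R,
    [/\ measurable_fun setT S, forall x, 0 <= S x,
      (db_int r n (fun x => (weight x * S x)%:E) <= eta%:E)%E &
      forall x, S x < 1 -> KS r F (ecdf r n x) <= L / Num.sqrt n%:R].
Proof.
move=> eta0; have [L [J0 [L0 conc]]] := ecdf_concentration mp p0 p1 (ltW K0) pK eta0.
exists (2 * L), (4 ^ J0)%N; split; first by rewrite mulr_gt0.
move=> n Nn; have n0 : (0 < n)%N by apply: leq_trans Nn; rewrite expn_gt0.
have [S [mS S0 SI SK]] := conc _ _ (trunc_log_max (isT : (1 < 4)%N) Nn)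
  (trunc_logP (isT : (1 < 4)%N) n0).
exists S; split=> // x /SK /le_trans; apply.
set J := trunc_log 4 n.
have sq : Num.sqrt n%:R <= 2 ^+ J.+1 :> R.
  rewrite -(ger0_norm (exprn_ge0 J.+1 (ler0n R 2))) -sqrtr_sqr ler_wsqrtr//.
  rewrite -exprM mulnC exprM -!natrX ler_nat ltnW//.
  exact: (trunc_log_ltn n (isT : (1 < 4)%N)).
have s0 : 0 < Num.sqrt n%:R :> R by rewrite sqrtr_gt0 ltr0n.
rewrite ler_pdivrMr ?exprn_gt0// mulrAC ler_pdivlMr//.
by rewrite [2 * L]mulrC -mulrA -exprS ler_pM2l.
Qed.

Section one_size.
Variables (n k : nat) (alpha d1 d2 e1 tau : R).
Variables (S1 : n.-tuple (r.-tuple R) -> R) (S2 : k.-tuple (r.-tuple R) -> R).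
Hypothesis alpha0 : 0 < alpha.
Let Delta : R := sensitivity r n k (KS r).
Hypothesis Delta0 : 0 < Delta.
Let A := alpha / (2 * Delta).
Hypotheses (mS1 : measurable_fun setT S1) (mS2 : measurable_fun setT S2).
Hypotheses (S10 : forall x, 0 <= S1 x) (S20 : forall z, 0 <= S2 z).
Hypothesis S1I : (db_int r n (fun x => (weight x * S1 x)%:E) <= e1%:E)%E.
Hypothesis S2I : (db_int r k (fun z => (weight z * S2 z)%:E) <= (1 / 2)%:E)%E.
Hypothesis S1d : forall x, S1 x < 1 -> KS r F (ecdf r n x) <= d1.
Hypothesis S2d : forall z, S2 z < 1 -> KS r F (ecdf r k z) <= d2.

Let A0 : 0 < A.
Proof. by rewrite divr_gt0 ?mulr_gt0. Qed.

Let g := expmech_g r n k (KS r) alpha.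

Let gE x z : g x z = expR (- (A * KS r (ecdf r n x) (ecdf r k z))).
Proof. by rewrite /g /expmech_g -/Delta; congr expR; rewrite /A mulrAC mulNr. Qed.

Let KS_ge0 G H : (forall t, 0 <= G t <= 1) -> (forall t, 0 <= H t <= 1) -> 0 <= KS r G H :> R.
Proof.
by move=> G1 H1; apply: le_trans (le_KS G1 H1 (@unit_cube0 R r)); exact: normr_ge0.
Qed.

Let ILk := @integral_like_db R r k.
Let ILn := @integral_like_db R r n.

Let Z x := fine (db_int r k (fun z => (g x z)%:E)).

Let ZE x : db_int r k (fun z => (g x z)%:E) = (Z x)%:E.
Proof.
rewrite fineK// fin_numElt; apply/andP; split.
  apply: (@lt_le_trans _ _ 0%E) => //; apply: (il_ge0 ILk) => z _.
  by rewrite lee_fin gE expR_ge0.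
apply: (@le_lt_trans _ _ 1%E); last by rewrite ltry.
rewrite -(il_1 ILk); apply: (il_le ILk) => z _; rewrite lee_fin gE ?expR_ge0//.
rewrite -expR0 ler_expR oppr_le0 mulr_ge0 ?(ltW A0)// KS_ge0//; exact: ecdf_bound.
Qed.

Let Z_ge0 x : 0 <= Z x.
Proof. by rewrite -lee_fin -ZE; apply: (il_ge0 ILk) => z _; rewrite lee_fin gE expR_ge0. Qed.

(* The density of the product law is at most [K ^+ k], so Lebesgue measure puts
   mass at least [(K ^+ k)^-1 / 2] on the samples close to [F]. *)
Lemma normalizer_ge x : S1 x < 1 -> expR (- (A * (d1 + d2))) / K ^+ k / 2 <= Z x.
Proof.
move=> S1x; set c := expR _ / K ^+ k.
have c0 : 0 < c by rewrite divr_gt0 ?expR_gt0 ?exprn_gt0.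
pose good z := (S2 z < 1)%R.
(* Markov's inequality in pointwise form: [1 <= (good z)%:R + S2 z]. Integrated against [weight],
   whose integral is 1, it leaves at least [1 - 1 / 2] for the good samples. *)
have half : ((1 / 2)%:E <= db_int r k (fun z => (weight z * (good z)%:R)%:E))%E.
  have mgood : measurable_fun setT (fun z => (weight z * (good z)%:R)%:E : \bar R).
    apply/measurable_EFinP; apply: measurable_funM.
      exact: measurable_weight.
    by apply: measurable_nat_of_bool; exact: measurable_fun_ltr.
  have : (1 <= db_int r k (fun z => (weight z * (good z)%:R)%:E) +
      db_int r k (fun z => (weight z * S2 z)%:E))%E.
    rewrite -(il_D ILk)//; first last.
    - by move=> z; rewrite lee_fin mulr_ge0.
    - by move=> z; rewrite lee_fin mulr_ge0.
    - by apply/measurable_EFinP; apply: measurable_funM => //; exact: measurable_weight.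
    rewrite -(db_int_weight k); apply: (il_le ILk) => z _; rewrite ?lee_fin//.
    rewrite -mulrDr ler_peMr// /good.
    by case: ltP => h; rewrite ?mulr1n ?mulr0n ?add0r// lerDl.
  move=> /le_trans /(_ (leeD (lexx _) S2I)); rewrite -leeBlDr//.
  apply: le_trans; rewrite -EFinB lee_fin; lra.
rewrite -lee_fin -ZE -[_ / 2]mulr1 -mulrA [2^-1 * 1]mulrC EFinM.
apply: (@le_trans _ _ (c%:E * db_int r k (fun z => (weight z * (good z)%:R)%:E))%E).
  by rewrite lee_pmul2l//.
rewrite -(il_Z ILk) ?(ltW c0)//; last by move=> z _; rewrite lee_fin mulr_ge0.
apply: (il_le ILk) => z dz.
  by rewrite -EFinM lee_fin; apply: mulr_ge0; [exact: ltW|exact: mulr_ge0].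
rewrite -EFinM lee_fin gE /good; case: ltP => S2z; last first.
  by rewrite mulr0n !mulr0 expR_ge0.
rewrite mulr1n mulr1 /c mulrAC -mulrA.
apply: (@le_trans _ _ (expR (- (A * (d1 + d2))) * 1)).
  rewrite ler_pM2l ?expR_gt0// ler_pdivrMr ?exprn_gt0// mul1r.
  rewrite -[X in _ <= _ ^+ X]card_ord -prodr_const.
  by apply: ler_prod => i _; rewrite p0 pK//; exact: dz.
rewrite mulr1 ler_expR lerN2 ler_pM2l//.
have := KS_triangle (ecdf_bound x) (cdf_bound p0 p1) (ecdf_bound z).
rewrite (KSC (ecdf r n x) (cdf_of_density r p)).
by have := S1d S1x; have := S2d S2z; rewrite /F; lra.
Qed.

(** The bound [expR (- (A * (tau - d1)))] on [g x z], valid when [S1 x < 1] and [z] is farther than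
    [tau] from [F], divided by the lower bound of [normalizer_ge]. *)
Let b := 2 * expR (A * (d1 + d2) - A * (tau - d1)) * K ^+ k.

(** Given [x], the conditional probability is at most [S1 x + b]: it is at most 1 if [S1 x >= 1],
    and at most [b] otherwise. Integration against [weight] concludes. *)
Lemma joint_prob_KS_le :
  (joint_prob r n k p (KS r) alpha
     (fun x z => (tau < KS r F (ecdf r k z))%R) <= (e1 + b)%:E)%E.
Proof.
have b0 : 0 <= b by rewrite !mulr_ge0 ?expR_ge0 ?exprn_ge0 ?(ltW K0).
have hE x z : expmech_h r n k (KS r) alpha x z = (Z x)^-1 * g x z.
  by rewrite mulrC.
have h0 x z : 0 <= (Z x)^-1 * g x z by rewrite mulr_ge0 ?invr_ge0// gE expR_ge0.
have inner x : db_space r n x ->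
    (db_int r k (fun z => (expmech_h r n k (KS r) alpha x z *
       (tau < KS r F (ecdf r k z))%R%:R)%:E) <= (S1 x + b)%:E)%E.
  move=> dx; have [S1x|S1x] := ltP (S1 x) 1; last first.
    apply: (@le_trans _ _ 1%E); last by rewrite lee_fin ler_wpDr.
    apply: (@le_trans _ _ (db_int r k (fun z => (Z x)^-1%:E * (g x z)%:E)%E)).
      apply: (il_le ILk) => z dz; rewrite hE; first by rewrite lee_fin mulr_ge0.
      by rewrite -EFinM lee_fin ler_piMr//; case: (_ < _)%R.
    rewrite (il_Z ILk) ?invr_ge0//; last by move=> z _; rewrite lee_fin gE expR_ge0.
    (* Here [normalizer_ge] does not apply; if [Z x] vanishes, the convention [0^-1 = 0] makes the
       total mass 0. *)
    rewrite ZE -EFinM lee_fin; have [->|Z0] := eqVneq (Z x) 0.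
      by rewrite invr0 mul0r.
    by rewrite mulVf.
  have Zx := normalizer_ge S1x.
  have Zx0 : 0 < Z x.
    by apply: lt_le_trans Zx; rewrite !divr_gt0 ?expR_gt0 ?exprn_gt0.
  apply: (@le_trans _ _ b%:E); last by rewrite lee_fin lerDr.
  rewrite -(il_cst ILk b0); apply: (il_le ILk) => z dz; rewrite hE lee_fin.
    by rewrite mulr_ge0.
  case: ltP => tz; last by rewrite mulr0n mulr0.
  rewrite mulr1n mulr1 ler_pdivrMl// gE.
  apply: (@le_trans _ _ (expR (- (A * (tau - d1))))).
    rewrite ler_expR lerN2 ler_pM2l// lerBlDl.
    have := KS_triangle (cdf_bound p0 p1) (ecdf_bound x) (ecdf_bound z).
    by have := S1d S1x; rewrite /F in tz *; lra.
  apply: le_trans (ler_wpM2r b0 Zx); rewrite le_eqVlt; apply/orP; left; apply/eqP.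
  rewrite /b expRD !expRN; field.
  by rewrite !gt_eqF ?expR_gt0 ?exprn_gt0.
rewrite /joint_prob.
apply: (@le_trans _ _ (db_int r n (fun x => (weight x * S1 x)%:E + b%:E * (weight x)%:E)%E)).
  apply: (il_le ILn) => x dx.
    apply: mule_ge0; first by rewrite lee_fin; exact: weight_ge0.
    apply: (il_ge0 ILk) => z dz.
    by rewrite hE lee_fin mulr_ge0.
  apply: (@le_trans _ _ ((weight x)%:E * (S1 x + b)%:E)%E).
    by apply: lee_wpmul2l; [rewrite lee_fin; exact: weight_ge0|exact: inner].
  by rewrite -!EFinM -EFinD lee_fin mulrDr [b * _]mulrC.
rewrite (il_D ILn); first last.
- by move=> x; rewrite -EFinM lee_fin mulr_ge0.
- by move=> x; rewrite lee_fin mulr_ge0.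
- under eq_fun do rewrite -EFinM; apply/measurable_EFinP.
  by apply: measurable_funM => //; exact: measurable_weight.
- by apply/measurable_EFinP; apply: measurable_funM => //; exact: measurable_weight.
rewrite (il_Z ILn)//; last by move=> x _; rewrite lee_fin.
by rewrite db_int_weight mule1 EFinD leeD2r.
Qed.

End one_size.
End mechanism.

(** * Rates *)

Section asymptotics.
Context {R : realType}.
Implicit Types x y : R.

Lemma powR_third_cube x : 0 <= x -> (x `^ (1 / 3)) ^+ 3 = x.
Proof.
move=> x0; rewrite -powR_mulrn ?powR_ge0// -powRrM (_ : 1 / 3 * 3%:R = 1 :> R) ?powRr1//.
by field.
Qed.

Lemma powR_two_thirds x : 0 <= x -> x `^ (2 / 3) = (x `^ (1 / 3)) ^+ 2.
Proof.
move=> x0; rewrite -[RHS]powR_mulrn ?powR_ge0// -powRrM; congr (_ `^ _).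
by field.
Qed.

Lemma powR_third_inv x : 0 < x -> (x^-1) `^ (1 / 3) = (x `^ (1 / 3))^-1.
Proof.
move=> x0; rewrite -[LHS]mulr1 -[X in _ * X](mulfV (x := x `^ (1 / 3))); last first.
  by rewrite gt_eqF// powR_gt0.
rewrite mulrA -powRM ?invr_ge0 ?(ltW x0)// mulVf ?gt_eqF//.
by rewrite powR1 mul1r.
Qed.

Lemma le_powR_third x y : 0 <= y -> y ^+ 3 <= x -> y <= x `^ (1 / 3).
Proof.
move=> y0 yx; have x0 : 0 <= x by apply: le_trans yx; exact: exprn_ge0.
by rewrite -(@ler_pXn2r _ 3) ?nnegrE ?powR_ge0// powR_third_cube.
Qed.

End asymptotics.

Section rate.
Context {R : realType} (r : nat) (p : r.-tuple R -> R).
Hypothesis mp : measurable_fun setT p.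
Hypothesis p0 : forall y, 0 <= p y.
Hypothesis p1 : cube_int r (fun y => (p y)%:E) = 1%E.
Variables (B alpha C : R) (k : nat -> nat) (N : nat).
Hypothesis pB : forall y, unit_cube r y -> p y <= expR B.
Hypotheses (r0 : (0 < r)%N) (B0 : 0 < B) (alpha0 : 0 < alpha) (C0 : 0 < C).
Hypothesis kn : forall n, (N <= n)%N ->
  (k n)%:R <= C * ((3 * alpha / B) `^ (2 / 3) * n%:R `^ (2 / 3)) /\
  (3 * alpha / B) `^ (2 / 3) * n%:R `^ (2 / 3) <= C * (k n)%:R.

Let eps n : R := 2 * (B / (3 * alpha)) `^ (1 / 3) * n%:R `^ (- (1 / 3)).

(** Everything is expressed in [X], the cube root of [n]: [eps n = 2 / (q * X)],
    [k n <= C * q ^+ 2 * X ^+ 2], and both sampling errors are of order [1 / X]. The bound [b] is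
    then at most [2 * expR (- X)], hence at most [2 / X]. *)
Lemma joint_prob_KS_rate (eta : R) : 0 < eta ->
  exists M : R, exists N : nat, forall n : nat, (N <= n)%N ->
    (joint_prob r n (k n) p (KS r) alpha
       (fun (x : n.-tuple (r.-tuple R)) (z : (k n).-tuple (r.-tuple R)) =>
          (M * eps n < KS r (cdf_of_density r p) (ecdf r (k n) z))%R) <= eta%:E)%E.
Proof.
move=> eta0; have K0 := expR_gt0 B.
have half0 : 0 < 1 / 2 :> R by lra.
have eta2 : 0 < eta / 2 by rewrite divr_gt0.
have [L1 [N1 [L10 conc1]]] := ecdf_concentration_sqrt mp p0 p1 K0 pB eta2.
have [L2 [N2 [L20 conc2]]] := ecdf_concentration_sqrt mp p0 p1 K0 pB half0.
pose q : R := (3 * alpha / B) `^ (1 / 3).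
have q0 : 0 < q by rewrite powR_gt0// divr_gt0// mulr_gt0.
(* From [q ^+ 2 * X ^+ 2 <= C * k n], the sampling error of [z] is at most [c2 / X]. *)
pose c2 := L2 * (Num.sqrt C / q).
have c20 : 0 < c2 by rewrite mulr_gt0// divr_gt0// sqrtr_gt0.
(* Chosen so that [alpha * n / 2 * (w / X) = B * C * q ^+ 2 * X ^+ 2 + X ^+ 2]: the first term
   absorbs [k n * B], the second gives the decay. *)
pose w : R := 2 / alpha * (B * C * q ^+ 2 + 1).
(* The factor [q / 2] turns [M * eps n] into [(2 * L1 + c2 + w) / X]; [L1] is doubled because [d1]
   enters both the numerator and the normalizer. *)
pose M : R := (2 * L1 + c2 + w) * q / 2.
(* The summands serve in turn for [1 <= X], for [2 / X <= eta / 2], for [N2 <= k n] and for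
   [0 < k n]. *)
pose Xmin : R := 1 + 4 / eta + N2%:R * C / q ^+ 2 + C / q ^+ 2.
have Xmin1 : 1 <= Xmin.
  have : 0 <= 4 / eta by rewrite divr_ge0// ltW.
  have : 0 <= N2%:R * C / q ^+ 2 by rewrite divr_ge0 ?exprn_ge0 ?mulr_ge0// ltW.
  have : 0 <= C / q ^+ 2 by rewrite divr_ge0 ?exprn_ge0// ltW.
  rewrite /Xmin; lra.
exists M, (N + N1 + (Num.truncn (Xmin ^+ 3)).+1)%N => n nN.
have nN01 := leq_trans (leq_addr _ _) nN.
have nN1 := leq_trans (leq_addl _ _) nN01.
have nN0 := leq_trans (leq_addr _ _) nN01.
have nT : ((Num.truncn (Xmin ^+ 3)).+1 <= n)%N := leq_trans (leq_addl _ _) nN.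
have [kle lek] := kn nN0.
pose X : R := n%:R `^ (1 / 3).
have X3 : X ^+ 3 = n%:R by exact: powR_third_cube.
have XX : Xmin <= X.
  apply: le_powR_third; first lra.
  by apply: le_trans (ltW (truncnS_gt _)) _; rewrite ler_nat.
have X1 : 1 <= X by lra.
have X0 : 0 < X by lra.
have n0 : (0 < n)%N := leq_trans (ltn0Sn _) nT.
have q2 : (3 * alpha / B) `^ (2 / 3) = q ^+ 2.
  by apply: powR_two_thirds; rewrite divr_ge0 ?mulr_ge0// ltW.
rewrite q2 powR_two_thirds// -/X in kle lek.
have epsE : eps n = 2 / (q * X).
  rewrite /eps powRN -/X -(invf_div (3 * alpha) B) powR_third_inv -/q.
    by rewrite invfM mulrA.
  by rewrite divr_gt0// mulr_gt0.
have kge (y : R) : 0 <= y -> y * C / q ^+ 2 <= X -> y <= (k n)%:R.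
  move=> y0 yX; have : y * C / q ^+ 2 * 1 <= X * X.
    by apply: ler_pM => //; rewrite divr_ge0 ?exprn_ge0 ?mulr_ge0// ltW.
  rewrite mulr1 ler_pdivrMr ?exprn_gt0// => h.
  rewrite -(ler_pM2r C0) [_%:R * C]mulrC; apply: le_trans lek.
  by rewrite [_ ^+ 2 * _]mulrC [X ^+ 2]expr2.
have kN2 : (N2 <= k n)%N.
  rewrite -(ler_nat R); apply: kge => //; apply: le_trans XX; rewrite /Xmin.
  have : 0 <= 4 / eta by rewrite divr_ge0// ltW.
  have : 0 <= C / q ^+ 2 by rewrite divr_ge0 ?exprn_ge0// ltW.
  lra.
have k0 : (0 < k n)%N.
  rewrite -(ler_nat R); apply: kge => //; apply: le_trans XX; rewrite /Xmin mul1r.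
  have : 0 <= 4 / eta by rewrite divr_ge0// ltW.
  have : 0 <= N2%:R * C / q ^+ 2 by rewrite divr_ge0 ?exprn_ge0 ?mulr_ge0// ltW.
  lra.
have [S1 [mS1 S10 S1I S1d]] := conc1 _ nN1.
have [S2 [mS2 S20 S2I S2d]] := conc2 _ kN2.
have /andP[Delta0 Delta1] := sensitivity_KS (R := R) r0 n0 k0.
have d1X : L1 / Num.sqrt n%:R <= L1 / X.
  rewrite ler_pM2l// lef_pV2 ?posrE// ?sqrtr_gt0 ?ltr0n//.
  rewrite -[leLHS](ger0_norm (ltW X0)) -sqrtr_sqr ler_wsqrtr// -X3.
  by rewrite ler_weXn2l.
have d2X : L2 / Num.sqrt (k n)%:R <= c2 / X.
  rewrite /c2 -[L2 * _ / X]mulrA ler_pM2l//.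
  have sk0 : 0 < Num.sqrt (k n)%:R :> R by rewrite sqrtr_gt0 ltr0n.
  rewrite -mulrA -invfM ler_pdivlMr ?mulr_gt0// mulrC ler_pdivrMr//.
  rewrite -sqrtrM ?(ltW C0)// -[leLHS](ger0_norm (mulr_ge0 (ltW q0) (ltW X0))).
  by rewrite -sqrtr_sqr ler_wsqrtr// exprMn.
apply: le_trans (joint_prob_KS_le mp p0 p1 K0 pB (M * eps n) alpha0 Delta0
  mS1 mS2 S10 S20 S1I S2I S1d S2d) _.
rewrite lee_fin; set A := alpha / _; set b := 2 * _ * _.
suff : b <= eta / 2 by lra.
(* This is the sensitivity bound [Delta <= 1 / n]. *)
have An : alpha * n%:R / 2 <= A.
  have nD : n%:R * sensitivity (R := R) r n (k n) (KS r) <= 1.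
    by rewrite -ler_pdivlMl ?ltr0n// mulr1.
  rewrite /A ler_pdivlMr ?mulr_gt0//.
  have := ler_wpM2l (ltW alpha0) nD; lra.
have MX : M * eps n = (2 * L1 + c2 + w) / X.
  by rewrite epsE /M; field; rewrite !gt_eqF.
have bX : b <= 2 * expR (- X).
  rewrite /b -mulrA ler_pM2l// -expRM_natl -expRD ler_expR MX.
  set d1 := L1 / Num.sqrt n%:R in d1X *; set d2 := L2 / Num.sqrt _ in d2X *.
  have w0 : 0 < w.
    by rewrite mulr_gt0 ?divr_gt0// ltr_wpDl// !mulr_ge0 ?exprn_ge0// ltW.
  have h1 : A * (d1 + d2) - A * ((2 * L1 + c2 + w) / X - d1) <= - (A * (w / X)).
    have A0 : 0 < A by rewrite divr_gt0// mulr_gt0.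
    have : A * (d1 + d1 + d2) <= A * (L1 / X + L1 / X + c2 / X).
      by rewrite ler_pM2l//; lra.
    lra.
  have h2 : alpha * n%:R / 2 * (w / X) <= A * (w / X).
    by rewrite ler_pM2r// divr_gt0.
  have h3 : alpha * n%:R / 2 * (w / X) = B * C * q ^+ 2 * X ^+ 2 + X ^+ 2.
    rewrite -X3 /w; field; by rewrite !gt_eqF.
  have h4 : (k n)%:R * B <= B * C * q ^+ 2 * X ^+ 2.
    have -> : B * C * q ^+ 2 * X ^+ 2 = C * (q ^+ 2 * X ^+ 2) * B by ring.
    by rewrite ler_pM2r.
  have h5 : X <= X ^+ 2 by rewrite expr2 ler_peMl// ltW.
  lra.
apply: le_trans bX _.
have : expR (- X) <= X^-1.
  by rewrite expRN lef_pV2 ?posrE ?expR_gt0//; have := expR_ge1Dx X; lra.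
have : X^-1 <= eta / 4.
  rewrite -[leRHS]invrK lef_pV2 ?posrE ?invr_gt0 ?divr_gt0// invf_div.
  apply: le_trans XX; rewrite /Xmin.
  have : 0 <= N2%:R * C / q ^+ 2 by rewrite divr_ge0 ?exprn_ge0 ?mulr_ge0// ltW.
  have : 0 <= C / q ^+ 2 by rewrite divr_ge0 ?exprn_ge0// ltW.
  lra.
lra.
Qed.

End rate.

(** * Independence from the values of the density outside the cube *)

Section density_extension.
Context {R : realType} (r : nat) (p p' : r.-tuple R -> R).
Hypothesis p0 : forall y, unit_cube r y -> 0 <= p y.
Hypothesis pp' : forall y, unit_cube r y -> p y = p' y.

Lemma eq_cdf_of_density : cdf_of_density r p = cdf_of_density r p'.
Proof.
apply/funext => t; congr fine; apply: (il_eq (@integral_like_cube R r)) => y cy.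
  by rewrite lee_fin mulr_ge0// p0.
by rewrite pp'.
Qed.

Lemma eq_joint_prob n k rho alpha E :
  joint_prob r n k p rho alpha E = joint_prob r n k p' rho alpha E.
Proof.
have eq_weight (x : n.-tuple (r.-tuple R)) : db_space r n x ->
    \prod_(i < n) p (tnth x i) = \prod_(i < n) p' (tnth x i).
  by move=> dx; apply: eq_bigr => i _; rewrite pp'//; exact: dx.
apply: (il_eq (@integral_like_db R r n)) => x dx; last by rewrite eq_weight.
apply: mule_ge0.
  by rewrite lee_fin prodr_ge0// => i _; apply/p0/dx.
apply: (il_ge0 (@integral_like_db R r k)) => z _; rewrite lee_fin mulr_ge0//.
rewrite divr_ge0 ?expR_ge0//; apply/fine_ge0/(il_ge0 (@integral_like_db R r k)) => s _.
by rewrite lee_fin expR_ge0.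
Qed.

End density_extension.

(** In dimension 0 the cube is a point of mass 1, so [p] is 1 there. Hence [0 < B] forces [0 < r],
    which [sensitivity_KS] requires. *)
Lemma ln_sup_density_dim0 (R : realType) (p : 0.-tuple R -> R) :
  cube_int 0 (fun y => (p y)%:E) = 1%E ->
  ln (sup [set p y | y in unit_cube 0]) = 0.
Proof.
move=> [p1]; rewrite (_ : [set p y | y in _] = [set 1]) ?sup1 ?ln1//.
apply/seteqP; split=> [_ [y _ <-]|_ ->]; first by rewrite (tuple0 y).
by exists [tuple] => //; case.
Qed.

Unset Implicit Arguments.
Set Strict Implicit.

Theorem mainTheorem10 (R : realType) (r : nat) (p : r.-tuple R -> R) (alpha : R)
  (k : nat -> nat) :
  measurable_fun (unit_cube r) p ->
  (forall y, unit_cube r y -> 0 <= p y) ->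
  cube_int r (fun y => (p y)%:E) = 1%E ->
  (exists C : R, forall y, unit_cube r y -> p y <= C) ->
  let B := ln (sup [set p y | y in unit_cube r]) in
  0 < B ->
  0 < alpha ->
  (exists C : R, 0 < C /\ exists N : nat, forall n : nat, (N <= n)%N ->
     (k n)%:R <= C * ((3 * alpha / B) `^ (2 / 3) * n%:R `^ (2 / 3)) /\
     (3 * alpha / B) `^ (2 / 3) * n%:R `^ (2 / 3) <= C * (k n)%:R) ->
  let eps := fun n : nat => 2 * (B / (3 * alpha)) `^ (1 / 3) * n%:R `^ (- (1 / 3)) in
  let F := cdf_of_density r p in
  forall eta : R, 0 < eta ->
  exists M : R, exists N : nat, forall n : nat, (N <= n)%N ->
    (joint_prob r n (k n) p (KS r) alpha
       (fun (x : n.-tuple (r.-tuple R)) (z : (k n).-tuple (r.-tuple R)) =>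
          (M * eps n < KS r F (ecdf r (k n) z))%R) <= eta%:E)%E.
Proof.
move=> mp p0 p1 [C0 pC] B B0 alpha0 [C [Cgt0 [N kn]]] eps F eta eta0.
have supP : has_ubound [set p y | y in unit_cube r].
  by exists C0 => _ [y cy <-]; exact: pC.
(* [ln] is 0 by convention at nonpositive arguments, contrary to [0 < B]. *)
have sup0 : 0 < sup [set p y | y in unit_cube r].
  by rewrite ltNge; apply/negP => /ln0 B_eq0; move: B0; rewrite /B B_eq0 ltxx.
have pB y : unit_cube r y -> p y <= expR B.
  by move=> cy; rewrite lnK ?posrE//; apply: ub_le_sup => //; exists y.
have r0 : (0 < r)%N.
  rewrite lt0n; apply/eqP => r_eq0; subst r.
  by move: B0; rewrite /B ln_sup_density_dim0// ltxx.
(* Extension by 0 makes measurability and nonnegativity hold on the whole space, as the preceding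
   sections assume. *)
pose p' y := if y \in unit_cube r then p y else 0.
have pp' y : unit_cube r y -> p y = p' y.
  by move=> cy; rewrite /p' mem_set.
have p'0 y : 0 <= p' y.
  by rewrite /p'; case: ifPn => // /[!inE] /p0.
have mp' : measurable_fun setT p'.
  have cubeE : (fun y => y \in unit_cube r) @^-1` [set true] = @unit_cube R r.
    by apply/seteqP; split => y /=; [move/set_mem|move/mem_set].
  apply: measurable_fun_if => //.
  - apply: (measurable_fun_bool true); rewrite setTI cubeE.
    exact: measurable_unit_cube.
  - by rewrite setTI cubeE.
have p'1 : cube_int r (fun y => (p' y)%:E) = 1%E.
  rewrite -p1; apply/esym/(il_eq (@integral_like_cube R r)) => y cy.
    by rewrite lee_fin p0.
  by rewrite pp'.
have p'B y : unit_cube r y -> p' y <= expR B by move=> cy; rewrite -pp'// pB.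
have [M [N' rate]] := joint_prob_KS_rate mp' p'0 p'1 p'B r0 B0 alpha0 Cgt0 kn eta0.
exists M, N' => n nN; rewrite (eq_joint_prob p0 pp') /F (eq_cdf_of_density p0 pp').
exact: rate.
Qed.
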